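(* Let $K$ be a field or a discrete valuation ring, and denote its maximal ideal by $\mathfrak m$ (so $\mathfrak m=0$ if $K$ is a field). Let $\Gamma$ be a convex polytope in $\mathbb R^n$ with vertices in $\mathbb Z^n$ and suppose that $\dim\Gamma=n$. Let $f_0,f_1,\dots,f_n\in K[x_1^{\pm1},\dots,x_n^{\pm1}]$ have supports in $\Gamma$, and take $g\in K[x_1^{\pm1},\dots,x_n^{\pm1}]$ with support in $(n+1)\Gamma$. Suppose that for every face $\gamma$ of $\Gamma$ the system $\overline f_{0\gamma}=\dots=\overline f_{n\gamma}=0$ has no solutions in $\left(\overline{K/\mathfrak m}\setminus\{0\}\right)^n$. Then there exist $h_0,\dots,h_n\in K[x_1^{\pm1},\dots,x_n^{\pm1}]$ with support in $n\Gamma$ such that $g=h_0f_0+\dots+h_nf_n$.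
   Context: The support of a Laurent polynomial is the set of exponent vectors of its monomials with non-zero coefficient. $\overline f_i$ is the reduction of $f_i$ modulo $\mathfrak m$. For $\sigma\subset\mathbb R^n$ and a Laurent polynomial $h$, $h_\sigma$ is obtained from $h$ by deleting all monomials whose exponent vectors lie outside $\sigma$; so $\overline f_{i\gamma}$ is $(\overline f_i)_\gamma$. Faces of $\Gamma$ are of all dimensions, from vertices up to $\Gamma$ itself (included). $\overline{K/\mathfrak m}$ is an algebraic closure of $K/\mathfrak m$. *)

(* Defs.v *)
From HB Require Import structures.
From mathcomp Require Import all_boot all_order all_algebra finmap.
From mathcomp Require Import all_classical reals.
From mathcomp Require Import analysis.convex.
From mathcomp Require multinomials.monalg.
(* The notations of [monalg] clash with those of the analysis library. *)
Import -(notations) monalg.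

Set Implicit Arguments.
Unset Strict Implicit.
Unset Printing Implicit Defensive.

Import Order.TTheory GRing.Theory Num.Theory.

Local Open Scope classical_set_scope.
Local Open Scope ring_scope.

(* Laurent polynomials in n variables over K: the group ring K[Z^n], an exponent
   vector being a row of integers.  [monalg] only puts a ring structure on
   [malg] for monoids in which 1 is the only unit, which excludes Z^n; hence the
   instances below. *)
Definition laurent (K : comNzRingType) (n : nat) : Type :=
  malg 'rV[int]_n K.

HB.instance Definition _ (K : comNzRingType) (n : nat) :=
  GRing.Zmodule.on (laurent K n).

Section LaurentRing.
Variables (K : comNzRingType) (n : nat).
Local Notation Z := 'rV[int]_n.
Local Notation T := (laurent K n).
Implicit Types (f g : T) (u v : Z) (a b : K).

Definition laurent_coef f u : K := mcoeff u f.

Definition laurent_monom a u : T := mkmalgU u a.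

Definition laurent_mul f g : T :=
  \sum_(u <- msupp f) \sum_(v <- msupp g)
    laurent_monom (laurent_coef f u * laurent_coef g v) (u + v).

Let monom0 u : laurent_monom 0 u = 0. Proof. exact: monalgU0. Qed.

Let monomD u : {morph laurent_monom^~ u : a b / a + b}.
Proof. exact: monalgUD. Qed.

Let coef_out f u : u \notin msupp f -> laurent_coef f u = 0.
Proof. exact: mcoeff_outdom. Qed.

Let mulw (d1 d2 : {fset Z}) f g :
  (msupp f `<=` d1)%fset -> (msupp g `<=` d2)%fset ->
  laurent_mul f g
  = \sum_(u <- d1) \sum_(v <- d2)
      laurent_monom (laurent_coef f u * laurent_coef g v) (u + v).
Proof.
move=> le1 le2; rewrite /laurent_mul (big_fset_incl _ le1) /=.
  apply: eq_bigr => u _; apply: big_fset_incl => // v _ /coef_out ->.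
  by rewrite mulr0 monom0.
by move=> u _ /coef_out fu; rewrite big1 // => v _; rewrite fu mul0r monom0.
Qed.

Let mulC : commutative laurent_mul.
Proof.
move=> f g; rewrite /laurent_mul exchange_big /=.
by apply: eq_bigr => u _; apply: eq_bigr => v _; rewrite mulrC addrC.
Qed.

Let mulDl : left_distributive laurent_mul +%R.
Proof.
move=> f1 f2 g; have le := fsubset_refl (msupp g).
rewrite (@mulw _ _ (f1 + f2) _ (msuppD_le f1 f2) le).
rewrite (@mulw _ _ f1 _ (fsubsetUl (msupp f1) (msupp f2)) le).
rewrite (@mulw _ _ f2 _ (fsubsetUr (msupp f1) (msupp f2)) le).
rewrite -big_split /=; apply: eq_bigr => u _.
rewrite -big_split /=; apply: eq_bigr => v _.
by rewrite -monomD -mulrDl; congr (laurent_monom (_ * _) _); apply: mcoeffD.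
Qed.

Let mulDr : right_distributive laurent_mul +%R.
Proof. by move=> f g h; rewrite mulC mulDl !(mulC f). Qed.

Let mul0l : left_zero 0 laurent_mul.
Proof. by move=> f; rewrite /laurent_mul msupp0 big_seq_fset0. Qed.

Let coefUU a u : laurent_coef (laurent_monom a u) u = a.
Proof. exact: mcoeffUU. Qed.

Let mulUg a u g : laurent_mul (laurent_monom a u) g
  = \sum_(v <- msupp g) laurent_monom (a * laurent_coef g v) (u + v).
Proof.
rewrite (mulw msuppU_le (fsubset_refl _)) big_seq_fset1.
by apply: eq_bigr => v _; rewrite coefUU.
Qed.

Let mulUU a b u v :
  laurent_mul (laurent_monom a u) (laurent_monom b v)
  = laurent_monom (a * b) (u + v).
Proof.
by rewrite (mulw msuppU_le msuppU_le) !big_seq_fset1 !coefUU.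
Qed.

Let laurentE f : f = \sum_(u <- msupp f) laurent_monom (laurent_coef f u) u.
Proof. exact: monalgE. Qed.

Let mul_suml (I : Type) (r : seq I) (F : I -> T) g :
  laurent_mul (\sum_(i <- r) F i) g = \sum_(i <- r) laurent_mul (F i) g.
Proof.
exact: (big_morph (laurent_mul^~ g) (fun x y => mulDl x y g) (mul0l g)).
Qed.

Let mul_sumr (I : Type) (r : seq I) (F : I -> T) g :
  laurent_mul g (\sum_(i <- r) F i) = \sum_(i <- r) laurent_mul g (F i).
Proof. by rewrite mulC mul_suml; apply: eq_bigr => i _; rewrite mulC. Qed.

Let mulA : associative laurent_mul.
Proof.
move=> f g h; rewrite [f]laurentE !mul_suml; apply: eq_bigr => u _.
rewrite [g]laurentE !(mul_suml, mul_sumr); apply: eq_bigr => v _.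
rewrite [h]laurentE !mul_sumr; apply: eq_bigr => w _.
by rewrite !mulUU mulrA addrA.
Qed.

Let mul1l : left_id (laurent_monom 1 0) laurent_mul.
Proof.
move=> f; rewrite mulUg [RHS]laurentE.
by apply: eq_bigr => u _; rewrite mul1r add0r.
Qed.

Let one_neq0 : laurent_monom 1 0 != 0.
Proof. by rewrite monalgU_eq0 oner_eq0. Qed.

HB.instance Definition _ :=
  GRing.Zmodule_isComNzRing.Build (laurent K n) mulA mulC mul1l mulDl one_neq0.

End LaurentRing.

Section LaurentOps.
Variable n : nat.

Definition real_point (R : realType) (u : 'rV[int]_n) : 'rV[R]_n :=
  map_mx intr u.

Definition support_in (R : realType) (K : comNzRingType) (f : laurent K n)
    (A : set 'rV[R]_n) : Prop :=
  forall u, laurent_coef f u != 0 -> A (real_point R u).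

Definition laurent_restrict (R : realType) (K : comNzRingType)
    (A : set 'rV[R]_n) (f : laurent K n) : laurent K n :=
  \sum_(u <- msupp f | `[< A (real_point R u) >])
    laurent_monom (laurent_coef f u) u.

Definition laurent_map (K K' : comNzRingType) (phi : K -> K')
    (f : laurent K n) : laurent K' n :=
  \sum_(u <- msupp f) laurent_monom (phi (laurent_coef f u)) u.

Definition laurent_eval (K : comNzRingType) (L : fieldType) (phi : K -> L)
    (z : 'rV[L]_n) (f : laurent K n) : L :=
  \sum_(u <- msupp f) phi (laurent_coef f u) * \prod_(j < n) z 0 j ^ u 0 j.

End LaurentOps.

Section Rings.
Variable K : idomainType.

(* Elements of [idealr K] are proper ideals, hence no condition J != K. *)
Definition maximal_ideal (I : idealr K) : Prop :=
  forall J : idealr K, {subset I <= J} -> {subset J <= I}.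

Definition is_field : Prop := forall x : K, x != 0 -> x \is a GRing.unit.

Definition is_pid : Prop :=
  forall I : idealr K, exists a : K, forall x, x \in I <-> exists b, x = b * a.

Definition is_dvr : Prop :=
  is_pid /\
  exists I : idealr K,
    [/\ maximal_ideal I, exists2 x, x \in I & x != 0 &
        forall J : idealr K,
          maximal_ideal J -> (exists2 x, x \in J & x != 0) -> J =i I].

Definition residue (m : idealr K) (x : K) : {ideal_quot m} :=
  \pi_({ideal_quot m})%qT x.

End Rings.

(* L is algebraically closed by its type, so this says that iota makes L an
   algebraic closure of k, when the commutative ring k is a field. *)
Definition algebraic_closure (k : comNzRingType) (L : closedFieldType)
    (iota : {rmorphism k -> L}) : Prop :=
  forall z : L, exists2 p : {poly k}, p != 0 & root (map_poly iota p) z.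

Section Polytopes.
Variables (R : realType) (n : nat).
Implicit Types A F : set 'rV[R]_n.

Definition polytope A : Prop :=
  exists2 s : seq 'rV[R]_n, s != [::] &
    A = smallest (@convex_set R 'rV[R]_n) [set` s].

(* Nonempty faces, A itself included (take c = 0 and b = 0). *)
Definition face A F : Prop :=
  F !=set0 /\
  exists (c : 'cV[R]_n) (b : R),
    (forall x, A x -> (x *m c) 0 0 <= b) /\
    F = A `&` [set x | (x *m c) 0 0 = b].

Definition vertex A (v : 'rV[R]_n) : Prop := face A [set v].

(* The largest k such that A contains k + 1 affinely independent points
   p, p + row 0 V, ..., p + row (k - 1) V. *)
Definition affine_dim A : nat :=
  \max_(k < n.+1 | `[< exists (p : 'rV[R]_n) (V : 'M[R]_(k, n)),
      [/\ A p, forall i, A (p + row i V) & row_free V] >]) k.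

Definition dilate (k : nat) A : set 'rV[R]_n := [set k%:R *: x | x in A].

End Polytopes.

(* Main.v *)
(** The graded ring of the polytope has the monomials with exponents in
    d Gamma as its part of degree d.  Everything happens over the algebraic
    closure L of the residue field: the monomials of degree n + 1 are coordinates
    on a finite free module, so once each of them is a combination of the f_i with
    coefficients of degree n over L, a maximal minor of the corresponding matrix is
    nonzero in L, hence a unit in the local ring K, and the system is solvable
    over K.

    Over L, the Nullstellensatz on the torus of each face shows, by downward
    induction on faces, that the monomial of every vertex v is nilpotent modulo the
    f_i; so the f_i generate the unit ideal, by coefficients of degree -1, once a
    vertex is inverted, and their Koszul complex is contractible there.  A chase in
    the double complex Cech (with respect to the vertices) x Koszul then gives the
    claim, provided the Cech complex is exact in all degrees d >= 0 (the vanishing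
    of H^i(O(d)) on the toric variety).  In multidegree (u, d), a set S of vertices
    is missing from that complex iff some functional l with l(u) < d min l(Gamma)
    attains its minimum over Gamma on all of S.  Since d >= 0, these functionals
    form a convex set, covered by the convex cells on which a given vertex is
    minimal, and exactness is the acyclicity of the nerve of this cover. *)

Require Import Defs.
From HB Require Import structures.
From mathcomp Require Import all_boot all_order all_algebra finmap.
From mathcomp Require Import all_classical reals.
From mathcomp Require Import interval_inference analysis.convex.
From mathcomp Require Import ring lra zify.
From mathcomp Require multinomials.monalg.
Import -(notations) monalg.

Set Implicit Arguments.
Unset Strict Implicit.
Unset Printing Implicit Defensive.

Import Order.TTheory GRing.Theory Num.Theory.

Local Open Scope classical_set_scope.
Local Open Scope ring_scope.

(** * Cochains on the subsets of an ordered set *)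

(** The chase closes because the degree of the target equals the number n + 1 of the polynomials.
    Koszul degree j sits in degree n + 1 - j, and this is never negative for j at most n + 1; the
    Cech complex is known to be exact in precisely such degrees. The Cech complex is augmented: the
    empty set of vertices is one of its indices and stands for the polytope ring itself. All
    localisations live inside the single ring of Laurent polynomials, and chart and degree only
    decide which exponents are allowed. Identities are therefore cheap, and the work lies in the
    supports. The Nullstellensatz on a torus gives no control of supports. It is regained by keeping
    only the exponents of affine weight -1 along the face and then multiplying by a high power of
    the product of the vertices on the face. This is why the induction on faces deals with products
    of vertices. *)

(* A cochain on the subsets of an ordered set of size [r] is a function on bit
   lists of size [r]; the recursion below produces the usual alternating signs. *)
Fixpoint cob (M : zmodType) (c : seq bool -> M) (s : seq bool) : M :=
  match s with
  | [::] => 0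
  | false :: s' => cob (fun t => c (false :: t)) s'
  | true :: s' => c (false :: s') - cob (fun t => c (true :: t)) s'
  end.

Section Coboundary.
Variable M : zmodType.
Implicit Types (c : seq bool -> M) (s t : seq bool).

Lemma eq_cob c c' s :
  (forall t, size t = size s -> c t = c' t) -> cob c s = cob c' s.
Proof.
elim: s c c' => [|[] s IH] c c' E //=.
  rewrite E //; congr (_ - _); apply: IH => t st; apply: E.
  by rewrite /= st.
by apply: IH => t st; apply: E; rewrite /= st.
Qed.

Lemma cobB c c' s : cob (fun t => c t - c' t) s = cob c s - cob c' s.
Proof.
elim: s c c' => [|[] s IH] c c' //=; first by rewrite subr0.
by rewrite IH !opprD addrACA.
Qed.

Lemma cob0 s : cob (fun=> 0 : M) s = 0.
Proof. by elim: s => [|[] s IH] //=; rewrite IH subr0. Qed.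

Lemma cob_morph (N : zmodType) (phi : M -> N) c s :
  phi 0 = 0 -> {morph phi : x y / x - y} ->
  phi (cob c s) = cob (fun t => phi (c t)) s.
Proof.
move=> phi0 phiB; elim: s c => [|[] s IH] c //=.
by rewrite phiB IH.
Qed.

Lemma cobN c s : cob (fun t => - c t) s = - cob c s.
Proof. by rewrite -(cob_morph (phi := -%R)) ?oppr0 // => x y; rewrite opprD. Qed.

Lemma cobD c c' s : cob (fun t => c t + c' t) s = cob c s + cob c' s.
Proof.
rewrite -[cob c' s]opprK -cobN -cobB; apply: eq_cob => t _.
by rewrite opprK.
Qed.

Lemma cob_cob c s : cob (cob c) s = 0.
Proof.
elim: s c => [|[] s IH] c //=.
by rewrite cobB IH subr0 subrr.
Qed.

Fixpoint subbits (t s : seq bool) : bool :=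
  match t, s with
  | [::], [::] => true
  | b :: t', b' :: s' => (b ==> b') && subbits t' s'
  | _, _ => false
  end.

Lemma subbits_refl s : subbits s s.
Proof. by elim: s => //= b s ->; rewrite implybb. Qed.

Lemma subbits_size t s : subbits t s -> size t = size s.
Proof. by elim: t s => [|b t IH] [|b' s] //= /andP[_ /IH ->]. Qed.

Lemma cob_neq0 c s : cob c s != 0 -> exists2 t, subbits t s & c t != 0.
Proof.
elim: s c => [|[] s IH] c; rewrite ?eqxx //=.
  have [c0|c0] := eqVneq (c (false :: s)) 0.
    rewrite c0 sub0r oppr_eq0 => /IH[t ts ct]; exists (true :: t) => //=.
  by move=> _; exists (false :: s); rewrite //= subbits_refl.
by move=> /IH[t ts ct]; exists (false :: t).
Qed.

Lemma cob_no_bits c s : ~~ has id s -> cob c s = 0.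
Proof. by elim: s c => [|[] s IH] c //=; exact: IH. Qed.

(** Restriction from the empty set to a single chart loses nothing; the chase ends by reading off an
    identity this way. *)
Lemma cob_one_bit c r i : (i < r)%N ->
  cob c (set_nth false (nseq r false) i true) = c (nseq r false).
Proof.
elim: r c i => [|r IH] c [|i] //= ir; last exact: IH.
rewrite cob_no_bits ?subr0 //.
by elim: (r).
Qed.

End Coboundary.

(** Exterior multiplication by the vector [e], with [c s] the coefficient of the basis element
    indexed by [s]; [cob] is the same formula with all entries of [e] equal to 1. *)
Fixpoint up (B : comNzRingType) (e : seq B) (c : seq bool -> B) s : B :=
  match s, e with
  | false :: s', _ :: e' => up e' (fun t => c (false :: t)) s'
  | true :: s', x :: e' => x * c (false :: s') - up e' (fun t => c (true :: t)) s'
  | _, _ => 0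
  end.

(** Contraction with [f], the Koszul differential. *)
Fixpoint down (B : comNzRingType) (f : seq B) (c : seq bool -> B) s : B :=
  match s, f with
  | false :: s', x :: f' => x * c (true :: s') + down f' (fun t => c (false :: t)) s'
  | true :: s', _ :: f' => - down f' (fun t => c (true :: t)) s'
  | _, _ => 0
  end.

Section Koszul.
Variable B : comNzRingType.
Implicit Types (e f : seq B) (c : seq bool -> B) (s t : seq bool).

Lemma eq_up e c c' s :
  (forall t, size t = size s -> c t = c' t) -> up e c s = up e c' s.
Proof.
elim: s e c c' => [|[] s IH] [|x e] c c' E //=.
  rewrite E //; congr (_ - _); apply: IH => t st; apply: E.
  by rewrite /= st.
by apply: IH => t st; apply: E; rewrite /= st.
Qed.

Lemma eq_down f c c' s :
  (forall t, size t = size s -> c t = c' t) -> down f c s = down f c' s.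
Proof.
elim: s f c c' => [|[] s IH] [|x f] c c' E //=.
  by congr (- _); apply: IH => t st; apply: E; rewrite /= st.
rewrite E //; congr (_ + _); apply: IH => t st; apply: E.
by rewrite /= st.
Qed.

Lemma up0 e s : up e (fun=> 0) s = 0.
Proof. by elim: s e => [|[] s IH] [|x e] //=; rewrite IH mulr0 subr0. Qed.

Lemma down0 f s : down f (fun=> 0) s = 0.
Proof. by elim: s f => [|[] s IH] [|x e] //=; rewrite IH ?oppr0 // mulr0 add0r. Qed.

Lemma upDM e a c c' s :
  up e (fun t => a * c t + c' t) s = a * up e c s + up e c' s.
Proof.
elim: s e c c' => [|[] s IH] [|x e] c c' //=; rewrite ?mulr0 ?addr0 //.
by rewrite IH; ring.
Qed.

Lemma downB f c c' s : down f (fun t => c t - c' t) s = down f c s - down f c' s.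
Proof.
elim: s f c c' => [|[] s IH] [|x f] c c' //=; rewrite ?subr0 //.
  by rewrite IH opprD.
by rewrite IH; ring.
Qed.

Lemma downN f c s : down f (fun t => - c t) s = - down f c s.
Proof.
by rewrite -[RHS]add0r -(down0 f s) -downB; apply: eq_down => t _; rewrite sub0r.
Qed.

Lemma downZ f a c s : down f (fun t => a * c t) s = a * down f c s.
Proof.
elim: s f c => [|[] s IH] [|x f] c //=; rewrite ?mulr0 //.
  by rewrite IH mulrN.
by rewrite IH; ring.
Qed.

Lemma downD f c c' s : down f (fun t => c t + c' t) s = down f c s + down f c' s.
Proof.
rewrite -[down f c' s]opprK -downN -downB; apply: eq_down => t _.
by rewrite opprK.
Qed.

Lemma down_down f c s : down f (down f c) s = 0.
Proof.
elim: s f c => [|[] s IH] [|x f] c //=.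
  by rewrite downN IH !oppr0.
by rewrite downD IH addr0 downZ mulrN addrC subrr.
Qed.

(** The two differentials of the double complex commute without a sign, since they act on different
    arguments. *)
Lemma down_cob f (c : seq bool -> seq bool -> B) s t :
  down f (fun t' => cob (c^~ t') s) t = cob (fun s' => down f (c s') t) s.
Proof.
elim: s c => [|[] s IH] c /=; first by rewrite down0.
  by rewrite downB IH.
by rewrite IH.
Qed.

(* The Koszul complex of a family generating the unit ideal is contractible. *)
Lemma koszul_homotopy e f c s : size e = size s -> size f = size s ->
  down f (up e c) s + up e (down f c) s = (\sum_(i < size s) e`_i * f`_i) * c s.
Proof.
elim: s e f c => [|b s IH] [|x e] [|y f] c //=.
  by rewrite big_ord0 mul0r addr0.
move=> [se] [sf]; rewrite big_ord_recl /=; case: b.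
  have /= E := IH e f (fun t => c (true :: t)) se sf.
  have -> : up e (fun t => - down f (fun t0 => c (true :: t0)) t) s
      = - up e (down f (fun t0 => c (true :: t0))) s.
    have := upDM e (-1) (down f (fun t0 => c (true :: t0))) (fun=> 0) s.
    rewrite up0 addr0 mulN1r => <-.
    by apply: eq_up => t _; rewrite mulN1r addr0.
  by rewrite mulrDl -E downB downZ; ring.
have /= E := IH e f (fun t => c (false :: t)) se sf.
by rewrite upDM mulrDl -E; ring.
Qed.

End Koszul.

(** * Acyclicity of convex covers *)

Section ConvexCover.
Variables (R : realFieldType) (X : lmodType R) (T : eqType) (ev : T -> X -> R).
Hypothesis ev_affine :
  forall g x y t, ev g ((1 - t) *: x + t *: y) = (1 - t) * ev g x + t * ev g y.
Implicit Types (U : X -> Prop) (W : seq T) (s t : seq bool).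

Definition convex_pred U :=
  forall x y (t : R), 0 <= t <= 1 -> U x -> U y -> U ((1 - t) *: x + t *: y).

Definition minimal_at W s x :=
  forall g h, g \in mask s W -> h \in W -> ev g x <= ev h x.

(* The nerve of the cover of [U] by the cells on which a given function of the
   family [W] is minimal. *)
Definition realised U W s := exists2 x, U x & minimal_at W s x.

Lemma mask_subbits W s t : subbits t s -> {subset mask t W <= mask s W}.
Proof.
elim: t s W => [|b t IH] [|b' s] // [|g W] // /andP[bb ts] h.
have IHh := IH s W ts h.
case: b bb => /= [->|_]; last first.
  by case: b' => // /IHh; rewrite ?inE => ->; rewrite ?orbT.
by rewrite !inE => /orP[->//|/IHh ->]; rewrite orbT.
Qed.

Lemma realised_subbits U W s t : subbits t s -> realised U W s -> realised U W t.
Proof.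
move=> ts [x Ux xs]; exists x => // g h /(mask_subbits ts); exact: xs.
Qed.

Variable M : zmodType.
Implicit Types (c b : seq bool -> M).

Definition off_nerve U W c :=
  forall s, size s = size W -> c s != 0 -> ~ realised U W s.

Lemma off_nerve_cob U W c : off_nerve U W c -> off_nerve U W (cob c).
Proof.
move=> cU s sW /cob_neq0[t ts ct] /(realised_subbits ts).
by apply: cU; rewrite // (subbits_size ts).
Qed.

(* Induction on [W = v :: W'], through the Mayer-Vietoris decomposition of [U]
   into the part [P] where [v] is minimal and the part [Q] where it is not
   strictly minimal. *)
Lemma convex_cover_acyclic U W c : convex_pred U -> (0 < size W)%N ->
    off_nerve U W c -> (forall s, size s = size W -> cob c s = 0) ->
  exists2 b, off_nerve U W b & forall s, size s = size W -> cob b s = c s.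
Proof.
elim: W U c => // v W IH U c cU _ offc dc.
have dct s : size s = size W -> cob (fun t => c (true :: t)) s = c (false :: s).
  move=> sW; have /= := dc (true :: s); rewrite sW => /(_ erefl) /eqP.
  by rewrite subr_eq0 => /eqP.
have dcf s : size s = size W -> cob (fun t => c (false :: t)) s = 0.
  by move=> sW; apply: (dc (false :: s)); rewrite /= sW.
pose P x := U x /\ forall h, h \in W -> ev v x <= ev h x.
pose Q x := U x /\ exists2 h, h \in W & ev h x <= ev v x.
have [[q0 Qq0]|noQ] := pselect (exists x, Q x); last first.
  (* If [v] is strictly minimal everywhere, it may be added to any realised set. *)
  have swap s : realised U (v :: W) (false :: s) -> realised U (v :: W) (true :: s).
    case=> x Ux xs; exists x => // g h; rewrite /= inE => /orP[/eqP->|gs] hW; last first.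
      exact: (xs g h).
    move: hW; rewrite inE => /orP[/eqP->//|hW].
    rewrite leNgt; apply/negP => /ltW hv; apply: noQ; exists x.
    by split=> //; exists h.
  exists (fun s => if s is false :: s' then c (true :: s') else 0).
    move=> [|[] s] //=; rewrite ?eqxx // => sW cs /swap; exact: offc.
  move=> [|[] s] //= [sW]; last exact: dct.
  by rewrite cob0 subr0.
have W0 : (0 < size W)%N by case: Qq0 => _ [h]; case: (W).
have cP : convex_pred P.
  move=> x y t t01 [Ux xW] [Uy yW]; split; first exact: cU.
  move=> h hW; rewrite !ev_affine; have := xW h hW; have := yW h hW.
  case/andP: t01 => t0 t1 yh xh; apply: lerD; apply: ler_wpM2l => //.
  by rewrite subr_ge0.
have real_PQ s : realised U W s -> realised P W s \/ realised Q W s.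
  case=> x Ux xs.
  have [xQ|xQ] := pselect (exists2 h, h \in W & ev h x <= ev v x).
    by right; exists x.
  left; exists x => //; split=> // h hW; rewrite leNgt; apply/negP => /ltW hv.
  by apply: xQ; exists h.
have real_P s : realised P W s -> realised U W s by case=> x [Ux _] xs; exists x.
have real_Q s : realised Q W s -> realised U W s by case=> x [Ux _] xs; exists x.
have real_f s : realised Q W s -> realised U (v :: W) (false :: s).
  case=> x [Ux [h hW hv]] xs; exists x => // g k /= gs.
  rewrite inE => /orP[/eqP->|]; last exact: xs.
  by apply: le_trans hv; exact: xs.
have real_t s : realised P W s -> realised Q W s -> realised U (v :: W) (true :: s).
  case=> x [Ux vx] xs [y [Uy [h hW hv]] ys].
  have [s0|] := boolP (mask s W == [::]).
    exists x => // g k; rewrite /= (eqP s0) inE => /eqP ->.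
    by rewrite inE => /orP[/eqP->|] //; exact: vx.
  case sW: (mask s W) => [//|g sg] _.
  have gs : g \in mask s W by rewrite sW mem_head.
  have gW : g \in W := mem_mask gs.
  have gvy : ev g y <= ev v y by apply: le_trans (ys g h gs hW) hv.
  have vgx := vx g gW.
  (* Along the segment [x, y] the value of [v] crosses that of [g]. *)
  have [t t01 gt] : exists2 t, 0 <= t <= 1 &
      (1 - t) * ev v x + t * ev v y = (1 - t) * ev g x + t * ev g y.
    pose a := ev g x - ev v x; pose d := ev v y - ev g y.
    have a0 : 0 <= a by rewrite subr_ge0.
    have d0 : 0 <= d by rewrite subr_ge0.
    have [ad|ad] := eqVneq (a + d) 0.
      exists 0; first by rewrite lexx ler01.
      have : a = 0 by lra.
      by rewrite /a subr0 !mul1r !mul0r !addr0 => /eqP; rewrite subr_eq0 => /eqP.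
    have ad0 : 0 < a + d by rewrite lt_def ad addr_ge0.
    exists (a / (a + d)).
      apply/andP; split; first by rewrite divr_ge0 // ltW.
      by rewrite ler_pdivrMr // mul1r lerDl.
    have /eqP := divfK ad a; rewrite -subr_eq0 => /eqP E.
    apply/eqP; rewrite -subr_eq0 -[X in _ == X]E; apply/eqP.
    by rewrite /a /d; ring.
  exists ((1 - t) *: x + t *: y); first exact: cU.
  have min_g k : k \in W -> ev g ((1 - t) *: x + t *: y) <= ev k ((1 - t) *: x + t *: y).
    move=> kW; rewrite !ev_affine; case/andP: t01 => t0 t1.
    apply: lerD; apply: ler_wpM2l => //; rewrite ?subr_ge0 //; first exact: xs.
    exact: ys.
  have all_g k : k \in v :: mask s W ->
      ev k ((1 - t) *: x + t *: y) = ev g ((1 - t) *: x + t *: y).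
    rewrite inE => /orP[/eqP->|ks]; first by rewrite !ev_affine.
    have kW := mem_mask ks.
    have ex : ev k x = ev g x by apply/le_anti; rewrite !xs.
    have ey : ev k y = ev g y by apply/le_anti; rewrite !ys.
    by rewrite !ev_affine ex ey.
  move=> k l ks; rewrite (all_g k ks) inE => /orP[/eqP->|]; last exact: min_g.
  by rewrite (all_g v) // mem_head.
(* The values [c (true :: s)] are split into a part off the nerve of [P] and a part off the nerve of
   [Q]. By [real_t] no [s] with a non-zero value is realised on both. *)
pose bP s := if `[< realised P W s >] then 0 else c (true :: s).
pose bQ s := c (true :: s) - bP s.
have offP : off_nerve P W bP.
  by move=> s _; rewrite /bP; case: asboolP; rewrite ?eqxx.
have offQ : off_nerve Q W bQ.
  move=> s sW; rewrite /bQ /bP; case: asboolP; rewrite ?subrr ?eqxx //.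
  rewrite subr0 => sP cs sQ; apply: (offc (true :: s)) => //=; first by rewrite sW.
  exact: real_t.
(* The connecting map of Mayer-Vietoris: [cob bP] is also [c (false :: s) - cob bQ], so it avoids
   what is realised on either part, hence what is realised on [U]. *)
have offd : off_nerve U W (cob bP).
  move=> s sW ds /real_PQ[]; first exact: off_nerve_cob ds.
  have E : cob bP s = c (false :: s) - cob bQ s.
    by rewrite /bQ cobB dct // opprB addrCA subrr addr0.
  have := ds; rewrite E => cs sQ.
  have [cf|cf] := eqVneq (c (false :: s)) 0; last first.
    by apply: (offc (false :: s)) => //=; [rewrite sW | exact: real_f].
  move: cs; rewrite cf sub0r oppr_eq0 => cs.
  exact: (off_nerve_cob offQ) cs sQ.
(* [Q] need not be convex, so the induction hypothesis is used on [U] and on [P] only. The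
   correction [e] turns [bP] into a cocycle over [P], and adding [e] to [bQ] gives the right
   coboundary directly. *)
have [e offe de] := IH U _ cU W0 offd (fun s _ => cob_cob bP s).
have [|s sW|b' offb' db'] := IH P (fun s => bP s - e s) cP W0.
- move=> s sW; have [e0|e0] := eqVneq (e s) 0; first by rewrite e0 subr0; exact: offP.
  by move=> _ /real_P; exact: offe.
- by rewrite cobB de // subrr.
exists (fun s => if s is b0 :: s' then if b0 then - b' s' else bQ s' + e s' else 0).
  move=> [|[] s] //= [sW].
    rewrite oppr_eq0 => bs [x Ux xs]; apply: (offb' s) => //; exists x.
      by split=> // h hW; apply: xs; rewrite inE ?eqxx ?hW ?orbT.
    by move=> g h gs hW; apply: xs; rewrite inE ?gs ?hW orbT.
  move=> ns [x Ux xs].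
  have [e0|e0] := eqVneq (e s) 0; last first.
    by apply: (offe s) => //; exists x => // g h gs hW; apply: xs; rewrite ?inE ?hW ?orbT.
  rewrite e0 addr0 in ns; apply: (offQ s) => //.
  (* An empty selection is realised on [Q] as soon as [Q] has a point; this is what [q0] is kept
     for. *)
  have [s0|] := boolP (mask s W == [::]).
    by exists q0 => // g h; rewrite (eqP s0).
  case ms: (mask s W) => [//|g sg] _.
  have gs : g \in mask s W by rewrite ms mem_head.
  exists x; last by move=> k l ks lW; apply: xs; rewrite ?inE ?lW ?orbT.
  split=> //; exists g; first exact: mem_mask gs.
  by apply: xs => //; rewrite mem_head.
move=> [|[] s] //= [sW].
  by rewrite cobN opprK db' // /bQ addrACA subrK subrr addr0.
by rewrite cobD de // /bQ cobB dct // subrK.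
Qed.

End ConvexCover.

(** * The double complex *)

Section DoubleComplex.
(** [D s d] stands for the degree [d] part of the localisation at the vertices marked by [s].
    Degrees are predicates because an element of [B] may have several of them. *)
Variables (B : comNzRingType) (D : seq bool -> int -> B -> Prop).
Hypotheses (D0 : forall s d, D s d 0)
  (DB : forall s d a b, D s d a -> D s d b -> D s d (a - b))
  (DM : forall s d e a b, D s d a -> D s e b -> D s (d + e) (a * b))
  (Dsub : forall s t d a, subbits t s -> D t d a -> D s d a).
Variables (r q : nat) (f : seq B).
Hypotheses (r_gt0 : (0 < r)%N) (size_f : size f = q)
  (Df : forall s i, D s 1 f`_i)
  (f_unit : forall s, size s = r -> has id s -> exists e : seq B,
     [/\ size e = q, forall i, D s (-1) e`_i & \sum_(i < q) e`_i * f`_i = 1])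
  (cech_exact : forall (d : nat) (c : seq bool -> B),
     (forall s, size s = r -> D s d (c s)) ->
     (forall s, size s = r -> cob c s = 0) ->
     exists2 b, forall s, size s = r -> D s d (b s) &
       forall s, size s = r -> cob b s = c s).
Implicit Types (s t : seq bool) (c y : seq bool -> seq bool -> B) (j : nat).

Let DN s d a : D s d a -> D s d (- a).
Proof. by rewrite -sub0r; exact: DB. Qed.

Let DD s d a b : D s d a -> D s d b -> D s d (a + b).
Proof. by move=> Da Db; rewrite -[b]opprK; apply/DB/DN. Qed.

Let D_cob d (c : seq bool -> B) s :
  (forall t, subbits t s -> D t d (c t)) -> D s d (cob c s).
Proof.
suff gen s' : (forall t, subbits t s' -> D s d (c t)) -> D s d (cob c s').
  by move=> Dc; apply: gen => t ts; apply: (Dsub ts); exact: Dc.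
elim: s' c => [|[] s' IH] c Dc //=.
  apply: DB; first by apply: Dc; rewrite /= subbits_refl.
  by apply: IH => t ts; exact: Dc.
by apply: IH => t ts; exact: Dc.
Qed.

Let D_up s d (e : seq B) (c : seq bool -> B) t : (forall i, D s (-1) e`_i) ->
  (forall t', size t' = size t -> D s d (c t')) -> D s (d - 1) (up e c t).
Proof.
elim: t e c => [|[] t IH] [|x e] c De Dc //=.
  apply: DB; first by rewrite addrC; apply: DM (De 0) _; apply: Dc.
  by apply: IH => [i|t' st]; [exact: (De i.+1) | apply: Dc; rewrite /= st].
by apply: IH => [i|t' st]; [exact: (De i.+1) | apply: Dc; rewrite /= st].
Qed.

Let D_down s d (g : seq B) (c : seq bool -> B) t : (forall i, D s 1 g`_i) ->
  (forall t', size t' = size t -> D s d (c t')) -> D s (d + 1) (down g c t).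
Proof.
elim: t g c => [|[] t IH] [|x g] c Dg Dc //=.
  by apply: DN; apply: IH => [i|t' st]; [exact: (Dg i.+1) | apply: Dc; rewrite /= st].
apply: DD; first by rewrite addrC; apply: DM (Dg 0) _; apply: Dc.
by apply: IH => [i|t' st]; [exact: (Dg i.+1) | apply: Dc; rewrite /= st].
Qed.

Let up_neq0 (e : seq B) (c : seq bool -> B) t : up e c t != 0 ->
  exists t', [/\ size t' = size t, count id t = (count id t').+1 & c t' != 0].
Proof.
elim: t e c => [|[] t IH] [|x e] c; rewrite /= ?eqxx //.
  have [c0|c0] := eqVneq (c (false :: t)) 0.
    rewrite c0 mulr0 sub0r oppr_eq0 => /IH[t' [st ct ct']].
    by exists (true :: t'); rewrite /= st ct.
  by move=> _; exists (false :: t).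
by move=> /IH[t' [st ct ct']]; exists (false :: t'); rewrite /= st ct.
Qed.

Let down_neq0 (g : seq B) (c : seq bool -> B) t : down g c t != 0 ->
  exists t', [/\ size t' = size t, count id t' = (count id t).+1 & c t' != 0].
Proof.
elim: t g c => [|[] t IH] [|x g] c; rewrite /= ?eqxx //.
  rewrite oppr_eq0 => /IH[t' [st ct ct']].
  by exists (true :: t'); rewrite /= st ct.
have [c0|c0] := eqVneq (c (true :: t)) 0; last by exists (true :: t).
rewrite c0 mulr0 add0r => /IH[t' [st ct ct']].
by exists (false :: t'); rewrite /= st ct.
Qed.

(* Cochains of Koszul degree [j]. *)
Let X j c := forall s t, size s = r -> size t = q ->
  D s (q%:Z - j%:Z) (c s t) /\ (count id t != j -> c s t = 0).

Let X_big j c s t : (q < j)%N -> X j c -> size s = r -> size t = q -> c s t = 0.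
Proof.
move=> qj Xc sr tq; apply: (Xc s t sr tq).2.
by rewrite neq_ltn (leq_ltn_trans (count_size id t)) ?tq.
Qed.

Let X_cob j c : X j c -> X j (fun s t => cob (c^~ t) s).
Proof.
move=> Xc s t sr tq; split.
  by apply: D_cob => t' /subbits_size ts; apply: (Xc t' t _ tq).1; rewrite ts.
move=> tj; rewrite -(cob0 B s); apply: eq_cob => t' ts.
by apply: (Xc t' t _ tq).2; rewrite // ts.
Qed.

Let X_down j c : X j.+1 c -> X j (fun s t => down f (c s) t).
Proof.
move=> Xc s t sr tq; split.
  have -> : q%:Z - j%:Z = q%:Z - j.+1%:Z + 1 by lia.
  apply: D_down => // t' tt; apply: (Xc s t' sr _).1; rewrite tt; exact: tq.
move=> tj; apply/eqP; apply: contraTT tj => /down_neq0[t' [st ct ct']].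
rewrite negbK -eqSS -ct; apply: contraNT ct' => tj.
by rewrite (Xc s t' sr _).2 // st.
Qed.

Let X_up j c (e : seq bool -> seq B) : X j c ->
  (forall s i, size s = r -> has id s -> D s (-1) (e s)`_i) ->
  X j.+1 (fun s t => if has id s then up (e s) (c s) t else 0).
Proof.
move=> Xc De s t sr tq; case: ifP => hs; last by split.
split.
  have -> : q%:Z - j.+1%:Z = q%:Z - j%:Z - 1 by lia.
  apply: D_up => [i|t' tt]; first exact: De.
  by apply: (Xc s t' sr _).1; rewrite tt.
move=> tj; apply/eqP; apply: contraTT tj => /up_neq0[t' [st ct ct']].
rewrite negbK ct eqSS; apply: contraNT ct' => tj.
by rewrite (Xc s t' sr _).2 // st.
Qed.

(** A zigzag [w] starts at [z] and climbs by Koszul homotopies until the Koszul degree exceeds [q],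
    where everything vanishes. Cech exactness then leads back down to an element of Koszul degree 1
    whose image is [z]. *)
Lemma double_complex_surjective z : D (nseq r false) q z ->
  exists h : 'I_q -> B, (forall i, D (nseq r false) (q%:Z - 1) (h i)) /\
    z = \sum_(i < q) h i * f`_i.
Proof.
move=> Dz.
have /choice[e eP] : forall s, exists e : seq B, size s = r -> has id s ->
    [/\ size e = q, forall i, D s (-1) e`_i & \sum_(i < q) e`_i * f`_i = 1].
  move=> s; have [/andP[/eqP sr hs]|ns] := boolP ((size s == r) && has id s).
    by have [e eP] := f_unit sr hs; exists e.
  by exists [::] => sr hs; rewrite sr eqxx hs in ns.
pose w0 s t := if (s == nseq r false) && (t == nseq q false) then z else 0.
(* On the empty set no vertex is inverted and no homotopy exists; the value 0 is right there because
   [cob] vanishes on it. *)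
pose step c s t := if has id s then up (e s) (fun t => cob (c^~ t) s) t else 0.
pose w j := iter j step w0.
have Xw j : X j (w j).
  elim: j => [|j IH]; last first.
    by apply: X_up; [exact: X_cob | move=> s i sr hs; case: (eP s sr hs)].
  move=> s t sr tq /=; rewrite subr0 /w0; case: andP => [[/eqP-> /eqP->]|_].
    by split=> //; rewrite count_nseq mul0n.
  by split.
have down_step c s t : size s = r -> size t = q ->
    (forall t, size t = q -> down f (fun t => cob (c^~ t) s) t = 0) ->
    down f (step c s) t = cob (c^~ t) s.
  move=> sr tq dc; rewrite /step; case hs: (has id s); last first.
    by rewrite down0 cob_no_bits // hs.
  have [se _ ef] := eP s sr hs.
  have := @koszul_homotopy _ (e s) f (fun t => cob (c^~ t) s) t.
  rewrite se size_f tq ef mul1r => /(_ erefl erefl) <-.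
  rewrite (eq_up _ (c' := fun=> 0)) ?up0 ?addr0 // => t' tt.
  by apply: dc; rewrite tt.
have down_w j s t : size s = r -> size t = q ->
    down f (w j.+1 s) t = cob ((w j)^~ t) s.
  elim: j s t => [|j IH] s t sr tq; apply: down_step => // {tq}t tq.
    rewrite down_cob -(cob0 B s); apply: eq_cob => s' ss.
    apply/eqP; apply/negPn/negP => /down_neq0[t' [st ct]].
    by move=> /eqP[]; apply: (Xw 0 s' t' _ _).2; rewrite ?ss ?st ?ct.
  rewrite down_cob -(cob_cob ((w j)^~ t) s); apply: eq_cob => s' ss.
  by apply: IH; rewrite // ss.
(* Downward induction on [j]: [y] corrects [w j] to a Cech cocycle by a Koszul boundary. *)
have descent k j : (j + k = q.+1)%N -> exists2 y, X j.+1 y &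
    forall s t, size s = r -> size t = q ->
      cob (fun s => w j s t - down f (y s) t) s = 0.
  elim: k j => [|k IH] j jk.
    exists (fun _ _ => 0) => [s t sr tq|s t sr tq]; first by split.
    apply: etrans (cob0 B s); apply: eq_cob => s' ss.
    have jq : (q < j)%N by rewrite -jk addn0.
    by rewrite (X_big jq (Xw j)) ?ss //= down0 subrr.
  have [y Xy dy] := IH j.+1 ltac:(by rewrite addSn -addnS).
  have Xc : X j.+1 (fun s t => w j.+1 s t - down f (y s) t).
    move=> s t sr tq; have [Dw Ew] := Xw j.+1 s t sr tq.
    have [Dy Ey] := X_down Xy sr tq.
    by split=> [|tj]; [exact: DB | rewrite Ew ?Ey ?subr0].
  have /choice[b bP] : forall t, exists b : seq bool -> B, size t = q ->
      forall s, size s = r -> [/\ D s (q%:Z - j.+1%:Z) (b s),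
        count id t != j.+1 -> b s = 0 & cob b s = w j.+1 s t - down f (y s) t].
    move=> t; have [tq|tq] := eqVneq (size t) q; last first.
      by exists (fun=> 0) => /eqP; rewrite (negPf tq).
    have [tj|tj] := eqVneq (count id t) j.+1; last first.
      exists (fun=> 0) => _ s sr; split=> //.
      by rewrite cob0 (Xc s t sr tq).2.
    (* A non-zero value needs [j.+1] of the [q] bits, so its degree [q - j.+1] is a natural number
       and [cech_exact] applies. *)
    have jq : (j.+1 <= q)%N by rewrite -tj -tq count_size.
    have qj : q%:Z - j.+1%:Z = (q - j.+1)%N%:Z by lia.
    have [||b Db db] := @cech_exact (q - j.+1) (fun s => w j.+1 s t - down f (y s) t).
    - by move=> s sr; rewrite -qj; exact: (Xc s t sr tq).1.
    - by move=> s sr; exact: dy.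
    exists b => _ s sr; split; [by rewrite qj; exact: Db | by [] | exact: db].
  exists (fun s t => b t s) => [s t sr tq|s t sr tq].
    by have [? ? ?] := bP t tq s sr.
  (* The coboundary of the corrected [w j] is [down] of [w j.+1 - cob b], which is [down f (y s)];
     two contractions give 0. *)
  rewrite cobB -down_w // -(down_cob f (fun s t => b t s)) -downB.
  rewrite -[RHS](down_down f (y s) t); apply: eq_down => t' tt.
  have [_ _ ->] := bP t' (etrans tt tq) s sr.
  by rewrite opprB addrCA subrr addr0.
have [y Xy dy] := descent q.+1 0 (add0n _).
have sr : size (nseq r false) = r := size_nseq _ _.
have tq : size (nseq q false) = q := size_nseq _ _.
have := dy (set_nth false (nseq r false) 0 true) (nseq q false) _ tq.
rewrite size_set_nth size_nseq (maxn_idPr r_gt0) => /(_ erefl).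
rewrite cob_one_bit // => /eqP; rewrite subr_eq0 /w /= /w0 !eqxx => /eqP ->.
exists (fun i => y (nseq r false) (set_nth false (nseq q false) i true)).
split=> [i|].
  by apply: (Xy _ _ sr _).1; rewrite size_set_nth size_nseq; apply/maxn_idPr.
elim: q f (y _) size_f => [|p IH] [|x g] c //=; first by rewrite big_ord0.
move=> [sg]; rewrite big_ord_recl /= mulrC; congr (_ + _).
exact: IH.
Qed.

End DoubleComplex.

(** * Points of rings of finite type *)

Definition ideal_pred (B : comNzRingType) (I : B -> Prop) :=
  [/\ I 0, forall a b, I a -> I b -> I (a + b) & forall a b, I b -> I (a * b)].

Definition prime_pred (B : comNzRingType) (I : B -> Prop) :=
  [/\ ideal_pred I, ~ I 1 & forall a b, I (a * b) -> I a \/ I b].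

Section Ideals.
Variables (B : comNzRingType).
Implicit Types I : B -> Prop.

Lemma ideal_predB I a b : ideal_pred I -> I a -> I b -> I (a - b).
Proof. by case=> _ ID IM Ia Ib; apply: ID => //; rewrite -mulN1r; exact: IM. Qed.

Lemma ideal_pred_sum I (J : Type) (s : seq J) (F : J -> B) :
  ideal_pred I -> (forall j, I (F j)) -> I (\sum_(j <- s) F j).
Proof. by case=> I0 ID _ IF; elim/big_ind: _. Qed.

Lemma prime_predX I a k : prime_pred I -> I (a ^+ k) -> I a.
Proof.
by case=> _ I1 Ip; elim: k => [|k IH] //; rewrite exprS => /Ip[].
Qed.

Lemma maximal_ideal_exists I : ideal_pred I -> ~ I 1 ->
  exists P, [/\ forall a, I a -> P a, ideal_pred P, ~ P 1 &
    forall a, ~ P a -> exists b c, P c /\ b * a + c = 1].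
Proof.
move=> [I0 ID IM] I1.
pose Pr (A : set B) := A = set0 \/
  [/\ forall a, I a -> A a, ideal_pred A & ~ A 1].
have [F FP Ftot|A [[A0|[IA idA A1]] Amax]] := @Zorn_bigcup B Pr.
- have [[A0 [FA0 nA0]]|noA] := pselect (exists A, F A /\ A <> set0); last first.
    left; apply/seteqP; split=> // x [A FA Ax].
    by apply: noA; exists A; split=> // A0; rewrite A0 in Ax.
  have good A x : F A -> A x -> [/\ forall a, I a -> A a, ideal_pred A & ~ A 1].
    by move=> FA Ax; case: (FP A FA) => // A00; rewrite A00 in Ax.
  right; split.
  + move=> a Ia; exists A0 => //; case: (FP A0 FA0) => // -[+ _ _]; exact.
  + split.
    * by exists A0 => //; case: (FP A0 FA0) => // -[_ []].
    * move=> a b [A1 F1 a1] [A2 F2 b2].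
      case: (Ftot A1 A2 F1 F2) => s12.
        by exists A2 => //; have [_ [_ + _] _] := good _ _ F2 b2; apply=> //; exact: s12.
      by exists A1 => //; have [_ [_ + _] _] := good _ _ F1 a1; apply=> //; exact: s12.
    * by move=> a b [A1 F1 b1]; exists A1 => //; have [_ [_ _ +] _] := good _ _ F1 b1; exact.
  + by case=> A FA A1; have [_ _] := good _ _ FA A1.
- exfalso; apply: (Amax I); last by right; split.
  by rewrite A0; split=> // /(_ 0 I0).
exists A; split=> // a nAa.
have [A00 AD AM] := idA.
pose J x := exists b c, A c /\ x = b * a + c.
have [J1|nJ1] := pselect (J 1); first by have [b [c [Ac ->]]] := J1; exists b, c.
exfalso; apply: (Amax J).
  split; last first.
    by move=> /(_ a) Ja; apply: nAa; apply: Ja; exists 1, 0; rewrite mul1r addr0.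
  by move=> c Ac; exists 0, c; rewrite mul0r add0r.
right; split=> //.
  by move=> c /IA Ac; exists 0, c; rewrite mul0r add0r.
split.
- by exists 0, 0; rewrite mul0r addr0.
- move=> _ _ [b [c [Ac ->]]] [b' [c' [Ac' ->]]]; exists (b + b'), (c + c').
  by split; [exact: AD | ring].
- move=> d _ [b [c [Ac ->]]]; exists (d * b), (d * c).
  by split; [exact: AM | ring].
Qed.

Lemma maximal_prime (P : B -> Prop) : ideal_pred P -> ~ P 1 ->
  (forall a, ~ P a -> exists b c, P c /\ b * a + c = 1) -> prime_pred P.
Proof.
move=> idP P1 Pmax; split=> // a b Pab.
have [Pa|nPa] := pselect (P a); [by left | right].
have [_ PD PM] := idP; have [d [c [Pc dc]]] := Pmax a nPa.
have -> : b = d * (a * b) + b * c by rewrite -[LHS]mulr1 -dc; ring.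
by apply: PD; exact: PM.
Qed.

End Ideals.

(* Every ring of finite type over the algebraically closed field [L] has this
   property, which is stable under adjunction of a variable. *)
Definition enough_points (L : fieldType) (B : comNzRingType) (kappa : L -> B) :=
  forall (P : B -> Prop) q, prime_pred P -> ~ P q ->
  exists phi : {rmorphism B -> L},
    [/\ forall c, phi (kappa c) = c, forall a, P a -> phi a = 0 & phi q != 0].

Section PolynomialPoints.
Variables (L : closedFieldType) (B : comNzRingType) (kappa : L -> B).

Lemma min_size_poly (S : {poly B} -> Prop) g0 : S g0 ->
  exists2 g, S g & forall h, S h -> (size g <= size h)%N.
Proof.
move=> Sg0; pose Q k := `[< exists h, S h /\ size h = k >].
have exQ : exists k, Q k by exists (size g0); apply/asboolP; exists g0.
case: (ex_minnP exQ) => k /asboolP[g [Sg sg]] kmin.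
exists g => // h Sh; rewrite sg; apply: kmin; apply/asboolP.
by exists h.
Qed.

Definition coef_in (p : B -> Prop) (h : {poly B}) := forall i, p h`_i.

Lemma coef_inM p h1 h2 : ideal_pred p -> coef_in p h2 -> coef_in p (h1 * h2).
Proof.
move=> idp h2p i; rewrite coefM; apply: ideal_pred_sum => // j.
by case: idp => _ _; apply.
Qed.

(** Leading terms with coefficient in [p] are cut off until one survives. This does the work of the
    degree in (B/p)[X] without forming the quotient. *)
Lemma lead_part p h : ideal_pred p -> ~ coef_in p h -> exists h1,
  [/\ ~ p (lead_coef h1), coef_in p (h - h1) & (size h1 <= size h)%N].
Proof.
move=> idp; have [p0 pD pM] := idp.
have [k] := ubnP (size h); elim: k h => // k IH h hk nh.
have [ph|] := pselect (p (lead_coef h)); last first.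
  by exists h; split=> // i; rewrite subrr coef0.
have h0 : (0 < size h)%N.
  by rewrite size_poly_gt0; apply/eqP => h0; apply: nh => i; rewrite h0 coef0.
have small : coef_in p (h - take_poly (size h).-1 h).
  move=> i; rewrite coefB coef_take_poly; case: ltnP => ih; first by rewrite subrr.
  rewrite subr0; move: ih; rewrite leq_eqVlt => /orP[/eqP <-//|].
  by rewrite prednK // => /leq_sizeP ->.
have st := size_take_poly (size h).-1 h.
have [||h1 [nh1 hh1 sh1]] := IH (take_poly (size h).-1 h).
- by rewrite (leq_ltn_trans st) // -ltnS prednK.
- move=> tp; apply: nh => i.
  rewrite -[h](subrK (take_poly (size h).-1 h)) coefD; exact: pD.
exists h1; split=> //; last by rewrite (leq_trans sh1) // (leq_trans st) // leq_pred.
move=> i; rewrite -[h](subrK (take_poly (size h).-1 h)) -addrA coefD.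
exact: pD.
Qed.

(** With [p] the contraction of [P] to [B], a point of [B] off a suitable element is extended to the
    new variable. Either [P] is p[X] and any value outside a finite set will do, or the value is a
    root of an element [g] of least degree in [P] outside p[X]. *)
Lemma enough_points_poly :
  enough_points kappa -> enough_points (fun c => (kappa c)%:P).
Proof.
move=> enough P q primeP nPq.
have [idP P1 Pp] := primeP; have [P0 PD PM] := idP.
pose p b := P b%:P.
have primep : prime_pred p.
  split=> [|//|a b]; last by rewrite /p polyCM => /Pp.
  split; rewrite /p ?polyC0 // => a b; first by rewrite polyCD; exact: PD.
  by rewrite polyCM; exact: PM.
have [idp _ pp] := primep; have [p0 pD _] := idp.
have inP h : coef_in p h -> P h.
  move=> hp; rewrite -[h]coefK poly_def; apply: ideal_pred_sum => // i.
  by rewrite -mul_polyC mulrC; apply: PM; exact: hp.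
have eval (phi : {rmorphism B -> L}) (xi : L) :
    exists psi : {rmorphism {poly B} -> L}, forall h, psi h = (map_poly phi h).[xi].
  pose cfu : commr_rmorph phi xi := fun x => mulrC _ _.
  by exists (horner_morph cfu).
have [allp|] := pselect (forall h, P h -> coef_in p h).
  have [j npj] : exists j, ~ p q`_j by apply/existsNP => /inP.
  have [phi [phiK phip phij]] := enough p q`_j primep npj.
  have [xi qxi] : exists x, ~~ root (map_poly phi q) x.
    apply/closed_nonrootP; apply: contraNneq phij => q0.
    by rewrite -coef_map q0 coef0.
  have [psi psiE] := eval phi xi.
  exists psi; split=> [c|a Pa|]; rewrite psiE.
  - by rewrite map_polyC hornerC; exact: phiK.
  - suff -> : map_poly phi a = 0 by rewrite horner0.
    by apply/polyP => i; rewrite coef_map coef0 /= phip //; exact: allp.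
  - exact: qxi.
move=> /existsNP[g0 /not_implyP[Pg0 ng0]].
have [g [Pg ng] gmin] := @min_size_poly (fun h => P h /\ ~ coef_in p h) g0 (conj Pg0 ng0).
have nlead_min (S : {poly B} -> Prop) h : (forall h1 h2, S h1 -> P h2 -> S (h1 + h2)) ->
    S h -> ~ coef_in p h -> (forall h', S h' /\ ~ coef_in p h' -> (size h <= size h')%N) ->
    ~ p (lead_coef h).
  move=> SD Sh nh hmin plh; have [h1 [nh1 hh1 sh1]] := lead_part idp nh.
  have Sh1 : S h1.
    rewrite -[h1](subKr h) -[- (h - h1)]mulN1r; apply: SD => //.
    by apply: PM; exact: inP.
  have ncoef : ~ coef_in p h1 by move=> /(_ (size h1).-1).
  have s1 : size h1 = size h by apply/eqP; rewrite eqn_leq sh1 hmin.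
  apply: nh1; rewrite /lead_coef s1 -[h1](subKr h) coefB; apply: ideal_predB => //.
have na : ~ p (lead_coef g) by apply: (@nlead_min P) => //.
(* [S] is the ideal generated by [P] and [q]. The aim is an element of it that is a constant outside
   [p]: such a constant forces [q] to be non-zero at any zero of [P] where the constant is
   non-zero. *)
pose S c := exists h b, P h /\ c = h + b * q.
have SD h1 h2 : S h1 -> P h2 -> S (h1 + h2).
  case=> h [b [Ph ->]] Ph2; exists (h + h2), b; split; first exact: PD.
  by rewrite addrAC.
have SM a h : S h -> S (a * h).
  case=> h' [b [Ph ->]]; exists (a * h'), (a * b); split; first exact: PM.
  by rewrite mulrDr mulrA.
have SP h : P h -> S h by move=> Ph; exists h, 0; rewrite mul0r addr0.
have Sq : S q by exists 0, 1; rewrite add0r mul1r.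
have SB h1 h2 : S h1 -> S h2 -> S (h1 - h2).
  move=> Sh1 [h [b [Ph ->]]]; rewrite opprD addrC -addrA addrC; apply: SD.
    rewrite addrC -mulNr; case: Sh1 => h' [b' [Ph' ->]]; exists h', (b' - b).
    by split=> //; ring.
  by rewrite -mulN1r; exact: PM.
have nq : ~ coef_in p q by move=> /inP.
have [c [Sc nc] cmin] := @min_size_poly (fun h => S h /\ ~ coef_in p h) q (conj Sq nq).
have nb : ~ p (lead_coef c) by apply: (@nlead_min S).
have c0 : c != 0 by apply: contra_notN nc => /eqP-> i; rewrite coef0; case: idp.
have rem_in h : S h -> exists k s r,
    [/\ (lead_coef c ^+ k) *: h = s * c + r, coef_in p r & (size r < size c)%N].
  move=> Sh; exists (Pdiv.Ring.rscalp h c), (Pdiv.Ring.rdivp h c), (Pdiv.Ring.rmodp h c).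
  have E := Pdiv.ComRing.rdivp_eq c h.
  have sr := Pdiv.Ring.ltn_rmodpN0 h c0.
  split=> //; apply: contrapT => nr; have := cmin (Pdiv.Ring.rmodp h c).
  rewrite leqNgt sr => H; suff : false by []; apply: H; split=> //.
  have -> : Pdiv.Ring.rmodp h c = lead_coef c ^+ Pdiv.Ring.rscalp h c *: h
      - Pdiv.Ring.rdivp h c * c by rewrite E addrAC subrr add0r.
  by rewrite -mul_polyC; apply: SB; exact: SM.
have nPc : ~ P c.
  move=> Pc; have [k [s [r [E /inP Pr sr]]]] := rem_in q Sq.
  have : P ((lead_coef c ^+ k) *: q) by rewrite E; apply: PD => //; exact: PM.
  by rewrite -mul_polyC => /Pp[/(prime_predX primep)|].
(* Pseudo-division of [g] by [c] leaves a remainder in p[X], so the quotient [s] lies in [P]. If [c]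
   had positive degree, [s] would have smaller degree than [g] modulo [p], against the choice of
   [g]. *)
have sc : (size c <= 1)%N.
  rewrite leqNgt; apply/negP => sc.
  have [k [s [r [E rp sr]]]] := rem_in g (SP g Pg).
  have [Ps|//] : P s \/ P c.
    apply: Pp; have -> : s * c = lead_coef c ^+ k *: g - r by rewrite E addrK.
    by apply: ideal_predB => //; [rewrite -mul_polyC; exact: PM | exact: inP].
  have ns : ~ coef_in p s.
    move=> sp; have: p (lead_coef c ^+ k * lead_coef g).
      rewrite /lead_coef -coefZ E coefD; apply: pD => //.
      by rewrite mulrC; exact: coef_inM.
    by move=> /pp[/(prime_predX primep)|].
  have [s1 [ns1 ss1 _]] := lead_part idp ns.
  have Ps1 : P s1.
    by rewrite -[s1](subKr s); apply: ideal_predB => //; exact: inP.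
  have ncs1 : ~ coef_in p s1 by move=> /(_ (size s1).-1).
  have gs1 := gmin s1 (conj Ps1 ncs1).
  have s10 : (0 < size s1)%N.
    by rewrite size_poly_gt0; apply: contra_notN ns1 => /eqP->; rewrite lead_coef0; case: idp.
  have nl : ~ p (lead_coef s1 * lead_coef c) by move=> /pp[].
  apply: nl; rewrite mul_lead_coef; set d := (_ + _).-2.
  have -> : s1 * c = (lead_coef c ^+ k) *: g - r - c * (s - s1) by rewrite E; ring.
  rewrite !coefB coefZ; apply: ideal_predB => //; last exact: coef_inM.
  apply: ideal_predB => //.
  rewrite [g`_d]nth_default ?mulr0; first by case: idp.
  by rewrite (leq_trans gs1) // /d; lia.
move: (size1_polyC sc) => cE.
have nr : ~ p c`_0 by move=> pc; apply: nPc; rewrite cE.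
(* Non-vanishing at the leading coefficient of [g] preserves its degree, so that a root exists, and
   lets pseudo-division by [g] show that [P] is killed. Non-vanishing at the constant takes care of
   [q]. *)
have [phi [phiK phip phiar]] :
    exists phi : {rmorphism B -> L}, [/\ forall c, phi (kappa c) = c,
      forall a, p a -> phi a = 0 & phi (lead_coef g * c`_0) != 0].
  by apply: enough => // /pp[].
move: phiar; rewrite rmorphM mulf_eq0 negb_or => /andP[phia phir].
have sg : (1 < size g)%N.
  rewrite ltnNge; apply/negP => /size1_polyC gE; apply: na.
  by rewrite gE lead_coefC /p -gE.
have [xi gxi] : exists x, root (map_poly phi g) x.
  apply/closed_rootP; rewrite size_map_poly_id0 //; lia.
have [psi psiE] := eval phi xi.
have psip h : coef_in p h -> psi h = 0.
  move=> hp; rewrite psiE; suff -> : map_poly phi h = 0 by rewrite horner0.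
  by apply/polyP => i; rewrite coef_map coef0 /= phip.
have psiC b : psi b%:P = phi b by rewrite psiE map_polyC hornerC.
have psiP h : P h -> psi h = 0.
  move=> Ph; have E := Pdiv.ComRing.rdivp_eq g h.
  have g0' : g != 0 by rewrite -size_poly_gt0; lia.
  have sr := Pdiv.Ring.ltn_rmodpN0 h g0'.
  have rp : coef_in p (Pdiv.Ring.rmodp h g).
    apply: contrapT => nr'; have := gmin (Pdiv.Ring.rmodp h g).
    rewrite leqNgt sr => H; suff : false by []; apply: H; split=> //.
    have -> : Pdiv.Ring.rmodp h g = lead_coef g ^+ Pdiv.Ring.rscalp h g *: h
        - Pdiv.Ring.rdivp h g * g by rewrite E addrAC subrr add0r.
    by rewrite -mul_polyC; apply: ideal_predB => //; exact: PM.
  have := congr1 psi E; rewrite -mul_polyC rmorphD !rmorphM (psip _ rp) addr0.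
  rewrite psiC rmorphXn (psiE g) (eqP gxi) mulr0 => /eqP.
  by rewrite mulf_eq0 expf_eq0 (negPf phia) andbF => /eqP.
exists psi; split=> [b|//|]; first by rewrite psiC.
apply: contra_neq phir => psiq; have [h [b [Ph cE']]] := Sc.
by rewrite -psiC -cE cE' rmorphD rmorphM psiP // psiq mulr0 addr0.
Qed.

End PolynomialPoints.

(** * Laurent polynomials *)

Section LaurentTheory.
Variables (K : comNzRingType) (n : nat).
Local Notation Z := 'rV[int]_n.
Implicit Types (f g : laurent K n) (u v : Z) (a b : K) (P Q : Z -> Prop).

Lemma laurent_ext f g : (forall u, laurent_coef f u = laurent_coef g u) -> f = g.
Proof. by move=> fg; apply/malgP. Qed.

Lemma laurent_coef0 u : laurent_coef (0 : laurent K n) u = 0.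
Proof. exact: mcoeff0. Qed.

Lemma laurent_coefD f g u : laurent_coef (f + g) u = laurent_coef f u + laurent_coef g u.
Proof. exact: mcoeffD. Qed.

Lemma laurent_coefB f g u : laurent_coef (f - g) u = laurent_coef f u - laurent_coef g u.
Proof. exact: mcoeffB. Qed.

Lemma laurent_coef_sum (I : Type) (s : seq I) (p : pred I) (F : I -> laurent K n) u :
  laurent_coef (\sum_(i <- s | p i) F i) u = \sum_(i <- s | p i) laurent_coef (F i) u.
Proof.
exact: (big_morph (fun f => laurent_coef f u) (fun f g => laurent_coefD f g u)
  (laurent_coef0 u)).
Qed.

Lemma laurent_coef_monom a v u : laurent_coef (laurent_monom a v) u = a *+ (v == u).
Proof. exact: mcoeffU. Qed.

Lemma mem_laurent_supp f u : (u \in msupp f) = (laurent_coef f u != 0).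
Proof. by rewrite -mcoeff_neq0. Qed.

Lemma laurent_monomE f : f = \sum_(u <- msupp f) laurent_monom (laurent_coef f u) u.
Proof. exact: monalgE. Qed.

Lemma laurent_monom0 u : laurent_monom (0 : K) u = 0.
Proof. exact: monalgU0. Qed.

Lemma laurent_monomB a b u :
  laurent_monom (a - b) u = laurent_monom a u - laurent_monom b u.
Proof. exact: monalgUB. Qed.

Lemma laurent1E : 1 = laurent_monom (1 : K) (0 : Z).
Proof. by []. Qed.

Lemma laurent_mulE f g : f * g = \sum_(u <- msupp f) \sum_(v <- msupp g)
  laurent_monom (laurent_coef f u * laurent_coef g v) (u + v).
Proof. by []. Qed.

Lemma laurent_monomM a b u v :
  laurent_monom a u * laurent_monom b v = laurent_monom (a * b) (u + v).
Proof.
have supp1 c w : c != 0 -> msupp (laurent_monom c w) = [fset w]%fset.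
  by move=> c0; rewrite /laurent_monom msuppU (negPf c0).
have [->|a0] := eqVneq a 0; first by rewrite laurent_monom0 !mul0r laurent_monom0.
have [->|b0] := eqVneq b 0; first by rewrite laurent_monom0 !mulr0 laurent_monom0.
by rewrite laurent_mulE !supp1 // !big_seq_fset1 !laurent_coef_monom !eqxx.
Qed.

Lemma laurent_monomX u k : laurent_monom (1 : K) u ^+ k = laurent_monom 1 (u *+ k).
Proof.
elim: k => [|k IH]; first by rewrite expr0 mulr0n.
by rewrite exprS IH laurent_monomM mul1r mulrS.
Qed.

Lemma laurent_monom_prod (I : Type) (s : seq I) (F : I -> Z) :
  \prod_(i <- s) laurent_monom (1 : K) (F i) = laurent_monom 1 (\sum_(i <- s) F i).
Proof.
elim: s => [|i s IH]; first by rewrite !big_nil.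
by rewrite !big_cons IH laurent_monomM mul1r.
Qed.

Definition supported f P := forall u, laurent_coef f u != 0 -> P u.

Lemma supported0 P : supported 0 P.
Proof. by move=> u; rewrite laurent_coef0 eqxx. Qed.

Lemma supportedD f g P : supported f P -> supported g P -> supported (f + g) P.
Proof.
move=> fP gP u; rewrite laurent_coefD.
have [->|f0] := eqVneq (laurent_coef f u) 0; first by rewrite add0r; exact: gP.
by move=> _; exact: fP.
Qed.

Lemma supportedB f g P : supported f P -> supported g P -> supported (f - g) P.
Proof.
move=> fP gP u; rewrite laurent_coefB.
have [->|f0] := eqVneq (laurent_coef f u) 0; last by move=> _; exact: fP.
by rewrite sub0r oppr_eq0; exact: gP.
Qed.

Lemma supported_sum (I : Type) (s : seq I) (F : I -> laurent K n) P :
  (forall i, supported (F i) P) -> supported (\sum_(i <- s) F i) P.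
Proof.
move=> FP; elim/big_ind: _ => [|f g|i _]; [exact: supported0|exact: supportedD|exact: FP].
Qed.

Lemma supported_monom a u P : (a != 0 -> P u) -> supported (laurent_monom a u) P.
Proof.
move=> Pu v; rewrite laurent_coef_monom; have [<-|_] := eqVneq u v; first exact: Pu.
by rewrite mulr0n eqxx.
Qed.

Lemma supported_impl f P Q : (forall u, P u -> Q u) -> supported f P -> supported f Q.
Proof. by move=> PQ fP u /fP/PQ. Qed.

Lemma supportedM f g P Q (S : Z -> Prop) : supported f P -> supported g Q ->
  (forall u v, P u -> Q v -> S (u + v)) -> supported (f * g) S.
Proof.
move=> fP gQ PQ; rewrite laurent_mulE; apply: supported_sum => u; apply: supported_sum => v.
apply: supported_monom => fg; have : ~~ ((laurent_coef f u == 0) || (laurent_coef g v == 0)).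
  apply: contraNN fg => /orP[] /eqP E; apply/eqP; rewrite E.
    by rewrite mul0r.
  by rewrite mulr0.
by rewrite negb_or => /andP[/fP Pu /gQ Qv]; exact: PQ.
Qed.

Lemma laurent_split P f : exists f1 f2,
  [/\ f = f1 + f2, supported f1 (fun u => P u /\ laurent_coef f u != 0)
    & supported f2 (fun u => ~ P u /\ laurent_coef f u != 0)].
Proof.
exists (\sum_(u <- msupp f) if `[< P u >] then laurent_monom (laurent_coef f u) u else 0).
exists (\sum_(u <- msupp f) if `[< P u >] then 0 else laurent_monom (laurent_coef f u) u).
split.
- rewrite -big_split [LHS]laurent_monomE; apply: eq_bigr => u _.
  by case: ifP => _ /=; rewrite ?addr0 ?add0r.
- apply: supported_sum => u; case: asboolP => Pu; last exact: supported0.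
  by apply: supported_monom.
- apply: supported_sum => u; case: asboolP => Pu; first exact: supported0.
  by apply: supported_monom => ?; split.
Qed.

End LaurentTheory.

Definition laurent_const (K : comNzRingType) n (c : K) : laurent K n := laurent_monom c 0.

Section LaurentConst.
Variables (K : comNzRingType) (n : nat).

Fact laurent_const_zmod : zmod_morphism (@laurent_const K n).
Proof. by move=> a b; exact: laurent_monomB. Qed.

Fact laurent_const_monoid : monoid_morphism (@laurent_const K n).
Proof. by split=> [|a b] //; rewrite /laurent_const laurent_monomM addr0. Qed.

HB.instance Definition _ := GRing.isZmodMorphism.Build K (laurent K n)
  (@laurent_const K n) laurent_const_zmod.
HB.instance Definition _ := GRing.isMonoidMorphism.Build K (laurent K n)
  (@laurent_const K n) laurent_const_monoid.
End LaurentConst.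

Lemma laurent_monomZ (K : comNzRingType) n (c : K) (u : 'rV[int]_n) :
  laurent_monom c u = laurent_const n c * laurent_monom 1 u.
Proof. by rewrite laurent_monomM mulr1 add0r. Qed.

(** * The Nullstellensatz on the torus *)

Fixpoint polys (K : comNzRingType) (m : nat) : comNzRingType :=
  if m is m'.+1 then {poly (polys K m')} else K.

Fixpoint polys_const (K : comNzRingType) m : K -> polys K m :=
  match m return K -> polys K m with
  | 0 => fun c => c
  | m'.+1 => fun c => (polys_const m' c)%:P
  end.

Fixpoint polys_var (K : comNzRingType) m (j : nat) : polys K m :=
  match m return polys K m with
  | 0 => 0
  | m'.+1 => if j == m' then 'X else (polys_var K m' j)%:P
  end.

Lemma polys_enough_points (L : closedFieldType) m : enough_points (@polys_const L m).
Proof.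
elim: m => [|m IH]; last exact: enough_points_poly IH.
move=> P q [[P0 PD PM] P1 Pp] nPq.
exists (idfun : {rmorphism L -> L}); split=> // [a Pa|]; last first.
  by apply: contra_notN nPq => /eqP /= ->.
apply: contrapT => /eqP /= a0; apply: P1.
by rewrite -(mulVf (a0 : (a : L) != 0)); exact: PM.
Qed.

Lemma polys_eval (K B : comNzRingType) (k : {rmorphism K -> B}) (b : nat -> B) m :
  exists theta : {rmorphism polys K m -> B},
    (forall c, theta (polys_const m c) = k c) /\
    forall j, (j < m)%N -> theta (polys_var K m j) = b j.
Proof.
elim: m => [|m [theta [thetaC thetaX]]]; first by exists k.
pose cfu : commr_rmorph theta (b m) := fun x => mulrC _ _.
exists (horner_morph cfu); split=> [c|j].
  by rewrite /= horner_morphC; exact: thetaC.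
rewrite ltnS leq_eqVlt => /orP[/eqP->|jm] /=.
  by rewrite eqxx horner_morphX.
by rewrite ltn_eqF // horner_morphC; exact: thetaX.
Qed.

(** A maximal ideal containing the [F i] is pulled back to a polynomial ring. The product of the
    variables stays outside it, being a unit among Laurent polynomials, so a point can be found with
    all coordinates non-zero. *)
Lemma torus_nullstellensatz (L : closedFieldType) n (J : finType)
    (F : J -> laurent L n) :
  ~ (exists z : 'rV[L]_n, (forall j, z 0 j != 0) /\
       forall i, laurent_eval idfun z (F i) = 0) ->
  exists a : J -> laurent L n, 1 = \sum_i a i * F i.
Proof.
move=> nozero; apply: contrapT => noa; apply: nozero.
pose I x := exists a : J -> laurent L n, x = \sum_i a i * F i.
have idI : ideal_pred I.
  split.
  - by exists (fun=> 0); rewrite big1 // => i _; rewrite mul0r.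
  - move=> _ _ [a ->] [b ->]; exists (fun i => a i + b i).
    by rewrite -big_split; apply: eq_bigr => i _; rewrite mulrDl.
  - move=> c _ [a ->]; exists (fun i => c * a i).
    by rewrite mulr_sumr; apply: eq_bigr => i _; rewrite mulrA.
have [P [IP idP P1 Pmax]] := maximal_ideal_exists idI noa.
have primeP := maximal_prime idP P1 Pmax; have [_ _ Pp] := primeP.
have [P0 PD PM] := idP.
pose x (j : nat) : laurent L n :=
  if insub j is Some i then laurent_monom 1 (delta_mx 0 i) else 0.
have xE (j : 'I_n) : x j = laurent_monom 1 (delta_mx 0 j) by rewrite /x valK.
have [theta [thetaC thetaX]] := polys_eval (@laurent_const L n) x n.
have thetaE (j : 'I_n) : theta (polys_var L n j) = laurent_monom 1 (delta_mx 0 j).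
  by rewrite thetaX.
pose Q p := P (theta p).
have primeQ : prime_pred Q.
  split=> [||a b]; rewrite /Q ?rmorph1 //; last by rewrite rmorphM => /Pp.
  by split=> [|a b|a b]; rewrite ?rmorph0 ?rmorphD ?rmorphM; [|exact: PD|exact: PM].
pose q := \prod_(j < n) polys_var L n j.
have nQq : ~ Q q.
  rewrite /Q rmorph_prod.
  under eq_bigr do rewrite thetaE.
  rewrite laurent_monom_prod => Pq; apply: P1.
  set u := \sum_(j < n) _ in Pq.
  by rewrite laurent1E -(addNr u) -[1]mul1r -laurent_monomM; exact: PM.
have [phi [phiC phiQ phiq]] := polys_enough_points primeQ nQq.
have z0 (j : 'I_n) : phi (polys_var L n j) != 0.
  apply: contraNneq phiq => j0; rewrite rmorph_prod (bigD1 j) //=.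
  by rewrite j0 mul0r.
exists (\row_j phi (polys_var L n j)); split=> [j|i]; first by rewrite mxE.
have PF : P (F i).
  apply: IP; exists (fun j => (j == i)%:R).
  by rewrite (bigD1 i) //= eqxx mul1r big1 ?addr0 // => j /negPf->; rewrite mul0r.
(* Multiplication by the [N]-th power of all variables clears the negative exponents of [F i]. *)
pose N := (\sum_(u <- msupp (F i)) \sum_(j < n) `|u 0%R j|)%N.
have uN u j : u \in msupp (F i) -> 0 <= u 0 j + N%:Z.
  move=> uF; have : (`|u 0%R j| <= N)%N; last by lia.
  rewrite /N (big_fsetD1 u) //= (bigD1 j) //=; lia.
pose G := \sum_(u <- msupp (F i)) polys_const n (laurent_coef (F i) u) *
  \prod_(j < n) polys_var L n j ^+ absz (u 0 j + N%:Z).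
have thetaM (k : 'I_n -> nat) : theta (\prod_(j < n) polys_var L n j ^+ k j)
    = laurent_monom 1 (\sum_(j < n) (delta_mx 0 j *+ k j)).
  rewrite rmorph_prod -laurent_monom_prod; apply: eq_bigr => j _.
  by rewrite rmorphXn thetaE laurent_monomX.
have QG : Q G.
  have -> : Q G = P (F i * laurent_monom 1 (\sum_(j < n) (delta_mx 0 j *+ N))).
    congr P; rewrite rmorph_sum [F i in RHS]laurent_monomE mulr_suml.
    rewrite big_seq [RHS]big_seq; apply: eq_bigr => u uF.
    rewrite rmorphM thetaC thetaM /laurent_const !laurent_monomM mulr1 add0r.
    congr laurent_monom.
    rewrite [u in RHS]row_sum_delta -big_split; apply: eq_bigr => j _ /=.
    apply/rowP => k; rewrite !mxE.
    have := uN u j uF; move: (u 0 j) => uj.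
    by rewrite !mulmxnE !mxE; case: (_ && _); lia.
  by rewrite mulrC; exact: PM.
have /eqP := phiQ G QG.
rewrite rmorph_sum (_ : \sum_(u <- _) _ = (\prod_(j < n) phi (polys_var L n j)) ^+ N *
    laurent_eval idfun (\row_j phi (polys_var L n j)) (F i)).
  rewrite mulf_eq0 expf_eq0 (negPf (_ : _ != 0)) ?andbF => [/eqP//|].
  by apply/prodf_neq0 => j _; exact: z0.
rewrite /laurent_eval mulr_sumr big_seq [RHS]big_seq; apply: eq_bigr => u uF.
rewrite rmorphM phiC rmorph_prod mulrCA; congr (_ * _).
rewrite -prodrXl -big_split; apply: eq_bigr => j _ /=.
by rewrite rmorphXn mxE !exprnP gez0_abs ?uN // expfzDr // mulrC.
Qed.

(** * Cones over polytopes *)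

Section Pairing.
Variables (R : realFieldType) (n : nat).
Implicit Types (x y : 'rV[R]_n) (l : 'cV[R]_n).

Definition dot x l : R := (x *m l) 0 0.

Lemma dotDl x y l : dot (x + y) l = dot x l + dot y l.
Proof. by rewrite /dot mulmxDl mxE. Qed.

Lemma dotBl x y l : dot (x - y) l = dot x l - dot y l.
Proof. by rewrite /dot mulmxBl !mxE. Qed.

Lemma dotZl a x l : dot (a *: x) l = a * dot x l.
Proof. by rewrite /dot -scalemxAl mxE. Qed.

Lemma dotBr x l l' : dot x (l - l') = dot x l - dot x l'.
Proof. by rewrite /dot mulmxBr !mxE. Qed.

Lemma dotDr x l l' : dot x (l + l') = dot x l + dot x l'.
Proof. by rewrite /dot mulmxDr !mxE. Qed.

Lemma dotZr a x l : dot x (a *: l) = a * dot x l.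
Proof. by rewrite /dot -scalemxAr mxE. Qed.

Lemma dot0l l : dot 0 l = 0.
Proof. by rewrite /dot mul0mx mxE. Qed.

Lemma dot_suml (I : Type) (s : seq I) (p : pred I) (F : I -> 'rV[R]_n) l :
  dot (\sum_(i <- s | p i) F i) l = \sum_(i <- s | p i) dot (F i) l.
Proof. exact: (big_morph (dot^~ l) (fun x y => dotDl x y l) (dot0l l)). Qed.

Lemma dot_sumr (I : Type) (s : seq I) (p : pred I) (F : I -> 'cV[R]_n) x :
  dot x (\sum_(i <- s | p i) F i) = \sum_(i <- s | p i) dot x (F i).
Proof.
apply: (big_morph (dot x)) => [l l'|]; first exact: dotDr.
by rewrite /dot mulmx0 mxE.
Qed.

(* Fourier-Motzkin style: when the functional found for [s] fails on [x i],
   project along [x i] onto its kernel. *)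
Lemma farkas (I : eqType) (s : seq I) (x : I -> 'rV[R]_n) y : uniq s ->
  (exists2 c : I -> R, forall i, 0 <= c i & y = \sum_(i <- s) c i *: x i) \/
  (exists2 l, forall i, i \in s -> 0 <= dot (x i) l & dot y l < 0).
Proof.
elim: s x y => [|i s IH] x y.
  move=> _; have [->|y0] := eqVneq y 0; first by left; exists (fun=> 0); rewrite ?big_nil.
  right; exists (- y^T) => //; rewrite /dot mulmxN mxE oppr_lt0 mxE.
  have /rV0Pn[j yj] := y0.
  rewrite (bigD1 j) //= mxE ltr_pwDl ?sumr_ge0 // => [|k _].
    by rewrite -expr2 lt_def sqr_ge0 sqrf_eq0 yj.
  by rewrite mxE -expr2 sqr_ge0.
move=> /= /andP[i_s us].
have extend (c : I -> R) a : (forall j, 0 <= c j) -> 0 <= a ->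
    exists2 c', forall j, 0 <= c' j &
      a *: x i + \sum_(j <- s) c j *: x j = \sum_(j <- i :: s) c' j *: x j.
  move=> c0 a0; exists (fun j => if j == i then a else c j).
    by move=> j; case: ifP.
  rewrite big_cons eqxx; congr (_ + _); apply: eq_big_seq => j js.
  by case: eqP => // ji; rewrite -ji js in i_s.
have [[c c0 yE]|[l ls ly]] := IH x y us.
  left; have [c' c'0 E] := extend c 0 c0 (lexx 0).
  by exists c'; rewrite // -E scale0r add0r.
have [li|li] := leP 0 (dot (x i) l).
  by right; exists l => // j; rewrite inE => /orP[/eqP->|/ls].
have li0 : dot (x i) l != 0 by rewrite lt_eqF.
pose proj z := z - (dot z l / dot (x i) l) *: x i.
have [[c c0 yE]|[mu mus muy]] := IH (fun j => proj (x j)) (proj y) us.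
  left; pose a := dot y l / dot (x i) l - \sum_(j <- s) c j * (dot (x j) l / dot (x i) l).
  have [|c' c'0 E] := extend c a c0.
    have inv0 : (dot (x i) l)^-1 <= 0 by rewrite invr_le0 ltW.
    rewrite /a subr_ge0 (@le_trans _ _ 0) //; last by rewrite mulr_le0 // ltW.
    rewrite big_seq sumr_le0 // => j js.
    by rewrite mulr_ge0_le0 // mulr_ge0_le0 // ls.
  exists c' => //; rewrite -E /a scalerBl -[LHS](subrK ((dot y l / dot (x i) l) *: x i)).
  rewrite -/(proj y) yE addrC -addrA; congr (_ + _).
  rewrite scaler_suml -sumrN -big_split; apply: eq_bigr => j _ /=.
  by rewrite /proj scalerBr scalerA addrC.
have dotE z : dot z (mu - (dot (x i) mu / dot (x i) l) *: l) = dot (proj z) mu.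
  by rewrite dotBr dotZr /proj dotBl dotZl; ring.
right; exists (mu - (dot (x i) mu / dot (x i) l) *: l) => [j|]; rewrite dotE //.
rewrite inE => /orP[/eqP->|/mus //].
by rewrite /proj dotBl dotZl mulfV // mul1r subrr.
Qed.

End Pairing.

Section ConeOverPolytope.
Variables (R : archiRealFieldType) (n : nat) (I : finType) (V : I -> 'rV[R]_n).
Implicit Types (d e : R) (x y : 'rV[R]_n) (l : 'cV[R]_n).

(** The slice at height [d] of the cone spanned by the vectors (V i, 1). Explicit weights make it
    possible to subtract a vertex, lowering the height by one. *)
Definition in_slice d y := exists c : I -> R,
  [/\ forall i, 0 <= c i, \sum_i c i = d & y = \sum_i c i *: V i].

Lemma in_slice0 : in_slice 0 0.
Proof.
by exists (fun=> 0); split=> //; rewrite big1 // => i _; rewrite scale0r.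
Qed.

Lemma in_sliceD d e x y : in_slice d x -> in_slice e y -> in_slice (d + e) (x + y).
Proof.
move=> [c [c0 cd ->]] [c' [c'0 c'e ->]]; exists (fun i => c i + c' i); split.
- by move=> i; rewrite addr_ge0.
- by rewrite big_split /= cd c'e.
- by rewrite -big_split; apply: eq_bigr => i _; rewrite scalerDl.
Qed.

Lemma in_sliceZ a d x : 0 <= a -> in_slice d x -> in_slice (a * d) (a *: x).
Proof.
move=> a0 [c [c0 cd ->]]; exists (fun i => a * c i); split.
- by move=> i; rewrite mulr_ge0.
- by rewrite -mulr_sumr cd.
- by rewrite scaler_sumr; apply: eq_bigr => i _; rewrite scalerA.
Qed.

Lemma in_slice_pt i : in_slice 1 (V i).
Proof.
exists (fun j => (j == i)%:R); split.
- by move=> j; exact: ler0n.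
- by rewrite (bigD1 i) //= eqxx big1 ?addr0 // => j /negPf->.
- rewrite (bigD1 i) //= eqxx scale1r big1 ?addr0 // => j /negPf->.
  by rewrite scale0r.
Qed.

Lemma in_slice_dual d y l b : in_slice d y -> (forall i, b <= dot (V i) l) ->
  d * b <= dot y l.
Proof.
move=> [c [c0 <- ->]] bV; rewrite dot_suml mulr_suml; apply: ler_sum => i _.
by rewrite dotZl ler_wpM2l.
Qed.

(** Farkas' lemma for the vectors (V i, 1): a functional on the larger space is a pair of some [l]
    and a constant [- b], and it is non-negative on them iff [b] bounds [l] from below. *)
Lemma in_sliceP d y :
  (forall l b, (forall i, b <= dot (V i) l) -> d * b <= dot y l) -> in_slice d y.
Proof.
move=> dual; pose x i : 'rV[R]_(n + 1) := row_mx (V i) 1%:M.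
have dotx z a (l : 'cV[R]_(n + 1)) : dot (row_mx z a%:M) l = dot z (usubmx l) + a * (dsubmx l) 0 0.
  rewrite /dot -[in LHS](vsubmxK l) mul_row_col mxE; congr (_ + _).
  by rewrite mul_scalar_mx mxE.
have [[c c0 E]|[l lV ly]] := farkas x (row_mx y d%:M) (enum_uniq I).
  exists c; rewrite big_enum /= in E; split=> //.
    have := congr1 (fun z => (rsubmx z) 0 0) E; rewrite row_mxKr mxE eqxx mulr1n => ->.
    rewrite raddf_sum summxE; apply: eq_bigr => i _.
    by rewrite /x scale_row_mx /= row_mxKr !mxE mulr1.
  have := congr1 lsubmx E; rewrite row_mxKl => ->.
  rewrite raddf_sum; apply: eq_bigr => i _.
  by rewrite /x scale_row_mx /= row_mxKl.
exfalso; have := dual (usubmx l) (- (dsubmx l) 0 0).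
rewrite dotx in ly; rewrite mulrN => H; suff : false by [].
have : - (d * dsubmx l 0 0) <= dot y (usubmx l); last by lra.
by apply: H => i; have := lV i; rewrite mem_enum dotx mul1r => /(_ isT); lra.
Qed.

(* The hypothesis says that [V v] lies on the smallest face containing [V t],
   [t \in T]. *)
Lemma in_slice_face_closure (T : {set I}) t0 v : t0 \in T ->
  (forall l b, (forall i, b <= dot (V i) l) -> (forall t, t \in T -> dot (V t) l = b) ->
     dot (V v) l = b) ->
  exists N : nat, in_slice (N.+1%:R * #|T|%:R - 1)
    (N.+1%:R *: (\sum_(t in T) V t) - V v).
Proof.
move=> t0T face.
(* These vectors span the cone of directions pointing into the polytope from the face. A functional
   non-negative on them is minimal on [T], hence by [face] equal at [V t0] and [V v], so Farkas puts
   [V t0 - V v] in the cone. *)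
pose x (it : I * I) := if it.2 \in T then V it.1 - V it.2 else 0.
have [[c c0 E]|[l lx ly]] := farkas x (V t0 - V v) (enum_uniq {: I * I}); last first.
  exfalso; have pos i t : t \in T -> dot (V t) l <= dot (V i) l.
    by move=> tT; have := lx (i, t); rewrite mem_enum /x /= tT dotBl subr_ge0 => /(_ isT).
  move: ly; rewrite dotBl (face l (dot (V t0) l)) ?subrr ?ltxx // => [i|t tT].
    exact: pos.
  by apply/le_anti; rewrite !pos.
rewrite big_enum /= in E.
(* Large enough for the weight of each point of [T] to absorb the subtracted [c] and the subtracted
   [V t0]. *)
pose N := Num.bound (\sum_it c it + 1).
have cN : \sum_it c it + 1 <= N%:R.
  by rewrite ltW // archi_boundP // addr_ge0 // sumr_ge0.
exists N; pose k i := (if i \in T then N.+1%:R - (i == t0)%:R - \sum_j c (j, i) else 0)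
  + \sum_(t in T) c (i, t).
exists k; split.
- move=> i; rewrite /k addr_ge0 //; last by rewrite sumr_ge0.
  case: ifP => // iT.
  have : \sum_j c (j, i) <= \sum_it c it.
    have -> : \sum_it c it = \sum_j \sum_i c (i, j).
      by rewrite exchange_big pair_bigA; apply: eq_bigr => -[].
    rewrite [X in _ <= X](bigD1 i) //= lerDl.
    by rewrite sumr_ge0 // => j _; rewrite sumr_ge0.
  have : (i == t0)%:R <= 1 :> R by case: eqP; rewrite ?ler01.
  by rewrite -addn1 natrD; lra.
- rewrite /k big_split /= -big_mkcond /= !sumrB sumr_const.
  rewrite (bigD1 t0 t0T) /= eqxx big1 => [|i /andP[_ /negPf->] //].
  rewrite [X in _ - X + _]exchange_big /= [X in _ + X]exchange_big /=.
  by rewrite exchange_big /= addr0 -addrA addNr addr0 mulr_natr.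
- have -> : \sum_i k i *: V i = N.+1%:R *: (\sum_(t in T) V t) - V t0
      + \sum_i \sum_(t in T) c (i, t) *: (V i - V t).
    rewrite /k; under eq_bigr do rewrite scalerDl.
    rewrite big_split /=.
    have -> : \sum_i (if i \in T then N.+1%:R - (i == t0)%:R - \sum_j c (j, i) else 0) *: V i
      = N.+1%:R *: (\sum_(t in T) V t) - V t0 - \sum_(t in T) \sum_j c (j, t) *: V t.
      rewrite (bigID (mem T)) /= [X in _ + X]big1 ?addr0 => [|i /negPf->]; last first.
        by rewrite scale0r.
      rewrite scaler_sumr -[V t0]scale1r.
      have -> : 1 *: V t0 = \sum_(t in T) (t == t0)%:R *: V t.
        rewrite (bigD1 t0 t0T) /= eqxx big1 ?addr0 // => i /andP[_ /negPf->].
        by rewrite scale0r.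
      rewrite -!sumrB; apply: eq_bigr => t tT.
      by rewrite tT !scalerBl scaler_suml.
    rewrite -addrA; congr (_ + _); rewrite addrC [X in _ - X]exchange_big -sumrB /=.
    apply: eq_bigr => i _; rewrite scaler_suml -sumrB; apply: eq_bigr => t _.
    by rewrite scalerBr.
  have -> : \sum_i \sum_(t in T) c (i, t) *: (V i - V t) = V t0 - V v.
    have -> : V t0 - V v = \sum_i \sum_t c (i, t) *: x (i, t).
      by rewrite E pair_bigA; apply: eq_bigr => -[].
    apply: eq_bigr => i _; rewrite big_mkcond; apply: eq_bigr => t _.
    by rewrite /x /=; case: ifP; rewrite ?scaler0.
  by rewrite addrA subrK.
Qed.

End ConeOverPolytope.

(** * Nilpotency of the vertices *)

Section RealPoint.
Variables (R : realType) (n : nat).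
Implicit Types u v : 'rV[int]_n.

Lemma real_pointD u v : real_point R (u + v) = real_point R u + real_point R v.
Proof. exact: map_mxD. Qed.

Lemma real_point0 : real_point R (0 : 'rV[int]_n) = 0.
Proof. exact: map_mx0. Qed.

Lemma real_pointN u : real_point R (- u) = - real_point R u.
Proof. exact: map_mxN. Qed.

Lemma real_pointMn u k : real_point R (u *+ k) = k%:R *: real_point R u.
Proof.
by rewrite scaler_nat; elim: k => [|k IH]; rewrite ?mulr0n ?real_point0 // !mulrS real_pointD IH.
Qed.

Lemma real_point_sum (J : Type) (s : seq J) (p : pred J) (F : J -> 'rV[int]_n) :
  real_point R (\sum_(j <- s | p j) F j) = \sum_(j <- s | p j) real_point R (F j).
Proof. exact: (big_morph _ real_pointD real_point0). Qed.

End RealPoint.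

Lemma laurent_coef_restrict (R : realType) (K : comNzRingType) n
    (A : set 'rV[R]_n) (f : laurent K n) u :
  laurent_coef (laurent_restrict A f) u =
    if `[< A (real_point R u) >] then laurent_coef f u else 0.
Proof.
rewrite /laurent_restrict laurent_coef_sum.
under eq_bigr do rewrite laurent_coef_monom.
have [uf|uf] := boolP (u \in msupp f); last first.
  have -> : laurent_coef f u = 0 by apply/eqP; rewrite -[_ == _]negbK -mem_laurent_supp.
  rewrite if_same big_seq_cond big1 // => v /andP[vf _].
  by case: eqVneq => // vu; rewrite vu (negPf uf) in vf.
rewrite big_mkcond (big_fsetD1 u) //= eqxx mulr1n big1_seq ?addr0 //.
by move=> v /andP[_]; rewrite !inE => /andP[/negPf-> _]; rewrite if_same.
Qed.

Lemma sum_replace (B : comNzRingType) (J : finType) (x y : B) (a F G : J -> B) :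
  1 = \sum_j a j * G j ->
  x * y = \sum_j (x * (y * a j)) * F j + \sum_j (x * (y * a j)) * (G j - F j).
Proof.
move=> aG; rewrite -big_split -[LHS]mulr1 aG mulr_sumr; apply: eq_bigr => j _ /=.
by rewrite -mulrDr addrC subrK !mulrA.
Qed.

Lemma regroup_multiple (M : zmodType) (w y u v : M) k :
  w *+ k + y *+ k.+1 + (u *+ k.+1 - v) + (w + v) = (w + y + u) *+ k.+1.
Proof.
rewrite [w + v]addrC addrA -(addrA _ (u *+ k.+1 - v) v) subrK.
by rewrite addrC !addrA -mulrS -!mulrnDl.
Qed.

(** Degree bookkeeping for [nilpotent_vertex_sum]; [m], [M] and [q] are predecessors of the
    quantities there, which removes truncated subtraction. *)
Lemma degree_count m M t q :
  (m.+1 * (M * t + M.+1 * q + M) + (m.+1 * t.+1).-1 = (m.+1 * M.+1 * (t + q.+1)).-1)%N.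
Proof.
have -> : (m.+1 * M.+1 * (t + q.+1) = m.+1 * (M * t + M.+1 * q + M) + m.+1 * t.+1)%N.
  by rewrite -mulnDr -mulnA; congr (_ * _)%N; lia.
by lia.
Qed.

Section Nilpotency.
Variables (R : realType) (n : nat) (I : finType) (V : I -> 'rV[int]_n).
Variables (L : closedFieldType) (J : finType) (F : J -> laurent L n).
Local Notation VR := (fun i => real_point R (V i)).

Definition lattice_slice (d : nat) u := in_slice VR d%:R (real_point R u).

Hypothesis suppF : forall j, supported (F j) (lattice_slice 1).
Hypothesis no_zero : forall (l : 'cV[R]_n) b, (forall i, b <= dot (VR i) l) ->
  (exists i, dot (VR i) l = b) ->
  ~ exists z : 'rV[L]_n, (forall j, z 0 j != 0) /\
      forall j, laurent_eval idfun z (laurent_restrict [set x | dot x l = b] (F j)) = 0.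

Implicit Types (d e k : nat) (h : laurent L n) (T : {set I}).

(** The index is the degree of the coefficients, one less than that of [h]. *)
Definition in_ideal d h := exists a : J -> laurent L n,
  (forall j, supported (a j) (lattice_slice d)) /\ h = \sum_j a j * F j.

(** Here [d] is the degree of [h] itself, whence the predecessor. *)
Definition nilpotent_mod d h := exists2 k, (0 < k)%N & in_ideal (k * d).-1 (h ^+ k).

Lemma lattice_sliceD d e u v :
  lattice_slice d u -> lattice_slice e v -> lattice_slice (d + e) (u + v).
Proof. by rewrite /lattice_slice real_pointD natrD; exact: in_sliceD. Qed.

Lemma lattice_slice0 : lattice_slice 0 0.
Proof. by rewrite /lattice_slice real_point0; exact: in_slice0. Qed.

Lemma lattice_sliceMn d k u : lattice_slice d u -> lattice_slice (k * d) (u *+ k).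
Proof. by rewrite /lattice_slice real_pointMn natrM => /in_sliceZ; apply; exact: ler0n. Qed.

Lemma in_ideal0 d : in_ideal d 0.
Proof.
exists (fun=> 0); split=> [j|]; first exact: supported0.
by rewrite big1 // => j _; rewrite mul0r.
Qed.

Lemma in_idealD d h1 h2 : in_ideal d h1 -> in_ideal d h2 -> in_ideal d (h1 + h2).
Proof.
move=> [a [aS ->]] [b [bS ->]]; exists (fun j => a j + b j); split=> [j|].
  exact: supportedD.
by rewrite -big_split; apply: eq_bigr => j _; rewrite mulrDl.
Qed.

Lemma in_idealM d e p h : supported p (lattice_slice e) -> in_ideal d h ->
  in_ideal (e + d) (p * h).
Proof.
move=> pS [a [aS ->]]; exists (fun j => p * a j); split=> [j|].
  by apply: supportedM (aS j) _; [exact: pS | move=> u v; exact: lattice_sliceD].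
by rewrite mulr_sumr; apply: eq_bigr => j _; rewrite mulrA.
Qed.

Lemma supportedX d h k : supported h (lattice_slice d) ->
  supported (h ^+ k) (lattice_slice (k * d)).
Proof.
move=> hS; elim: k => [|k IH].
  by rewrite expr0 laurent1E; apply: supported_monom => _; exact: lattice_slice0.
rewrite exprS mulSn; apply: supportedM hS IH _ => u v; exact: lattice_sliceD.
Qed.

Lemma nilpotent_modD d h1 h2 : (0 < d)%N ->
  supported h1 (lattice_slice d) -> supported h2 (lattice_slice d) ->
  nilpotent_mod d h1 -> nilpotent_mod d h2 -> nilpotent_mod d (h1 + h2).
Proof.
move=> d0 S1 S2 [k k0 I1] [l l0 I2]; exists (k + l)%N; first by rewrite addn_gt0 k0.
rewrite exprDn; elim/big_ind: _ => [|x y|i _]; [exact: in_ideal0|exact: in_idealD|].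
rewrite -mulr_natl.
have natS m : supported (m%:R : laurent L n) (lattice_slice 0).
  elim: m => [|m IH]; first exact: supported0.
  rewrite -natr1; apply: supportedD => //; rewrite laurent1E.
  by apply: supported_monom => _; exact: lattice_slice0.
rewrite -[(_ * d).-1]add0n; apply: in_idealM => //.
have ikl : (i <= k + l)%N by rewrite -ltnS.
have [li|il] := leqP l i.
  have -> : ((k + l) * d).-1 = ((k + l - i) * d + ((i - l) * d + (l * d).-1))%N by nia.
  apply: in_idealM; first exact: supportedX.
  rewrite -[X in h2 ^+ X](subnK li) exprD; apply: in_idealM => //; exact: supportedX.
have -> : ((k + l) * d).-1 = (i * d + ((l - i) * d + (k * d).-1))%N by nia.
rewrite mulrC; apply: in_idealM; first exact: supportedX.
have -> : (k + l - i = (l - i) + k)%N by lia.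
by rewrite exprD; apply: in_idealM => //; exact: supportedX.
Qed.

Lemma nilpotent_mod_sum d h : (0 < d)%N ->
  supported h (fun u => lattice_slice d u /\ nilpotent_mod d (laurent_monom 1 u)) ->
  nilpotent_mod d h.
Proof.
move=> d0 hS; rewrite [h]laurent_monomE big_seq.
suff [] : nilpotent_mod d (\sum_(u <- msupp h | u \in msupp h) laurent_monom (laurent_coef h u) u)
  /\ supported (\sum_(u <- msupp h | u \in msupp h) laurent_monom (laurent_coef h u) u)
       (lattice_slice d) by [].
elim/big_ind: _ => [|x y [nx sx] [ny sy]|u uh].
- split; last exact: supported0.
  by exists 1%N => //; rewrite expr1; exact: in_ideal0.
- by split; [exact: nilpotent_modD | exact: supportedD].
have [ud [k k0 Ik]] : lattice_slice d u /\ nilpotent_mod d (laurent_monom 1 u).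
  by apply: hS; rewrite -mem_laurent_supp.
split; last by apply: supported_monom.
exists k; first exact: k0.
rewrite laurent_monomZ exprMn -[(_ * d).-1]add0n.
apply: in_idealM Ik; rewrite -[0%N](muln0 k).
by apply: supportedX; apply: supported_monom => _; exact: lattice_slice0.
Qed.

Lemma lattice_slice_sum T : lattice_slice #|T| (\sum_(t in T) V t).
Proof.
rewrite /lattice_slice real_point_sum -sumr_const.
elim/big_ind2: _ => [|d x e y|i _]; [exact: in_slice0|exact: in_sliceD|].
exact: (in_slice_pt VR i).
Qed.

Lemma in_ideal_monom d e u v : in_ideal d (laurent_monom 1 u) ->
  lattice_slice e v -> in_ideal (e + d) (laurent_monom 1 (v + u)).
Proof.
move=> Iu ev; rewrite -[1]mul1r -laurent_monomM; apply: in_idealM => //.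
exact: supported_monom.
Qed.


Lemma uniform_shift (D : seq 'rV[int]_n) (w : 'rV[R]_n) (m c : nat) :
  (forall u, u \in D -> exists N0 : nat, forall N, (N0 <= N)%N ->
     in_slice VR (N%:R * m%:R - c%:R) (N%:R *: w + real_point R u)) ->
  exists N0 : nat, forall N u, (N0 <= N)%N -> u \in D ->
     in_slice VR (N%:R * m%:R - c%:R) (N%:R *: w + real_point R u).
Proof.
elim: D => [|u D IH] H; first by exists 0%N.
have [u' u'D|N1 N1P] := IH; first by apply: H; rewrite inE u'D orbT.
have [N2 N2P] := H u (mem_head _ _).
exists (maxn N1 N2) => N u'; rewrite geq_max inE => /andP[N1N N2N] /orP[/eqP->|].
  exact: N2P.
exact: N1P.
Qed.

(* For weight [0] this is the linear span of the differences of points of [T],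
   for weight [1] the affine span of [T]. *)
Definition affine_on T (w : R) u := exists c : I -> R,
  [/\ forall i, i \notin T -> c i = 0, \sum_i c i = w & real_point R u = \sum_i c i *: VR i].

Lemma affine_onD T w w' u v : affine_on T w u -> affine_on T w' v ->
  affine_on T (w + w') (u + v).
Proof.
move=> [c [cT cw cu]] [c' [cT' cw' cv]]; exists (fun i => c i + c' i); split.
- by move=> i iT; rewrite cT ?cT' ?addr0.
- by rewrite big_split /= cw cw'.
- rewrite real_pointD cu cv -big_split; apply: eq_bigr => i _.
  by rewrite scalerDl.
Qed.

Lemma affine_onN T w u : affine_on T w u -> affine_on T (- w) (- u).
Proof.
move=> [c [cT cw cu]]; exists (fun i => - c i); split.
- by move=> i iT; rewrite cT ?oppr0.
- by rewrite sumrN cw.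
- by rewrite real_pointN cu -sumrN; apply: eq_bigr => i _; rewrite scaleNr.
Qed.

(** Negative weights occur on [T] only, where a large multiple of the sum over [T] makes up for
    them. *)
Lemma affine_on_shift T w u : (0 < #|T|)%N -> affine_on T w u ->
  exists N0 : nat, forall N, (N0 <= N)%N ->
    in_slice VR (N%:R * #|T|%:R + w) (N%:R *: (\sum_(t in T) VR t) + real_point R u).
Proof.
move=> T0 [c [cT cw cu]]; exists (Num.bound (\sum_i `|c i|)) => N N0.
have cN i : `|c i| <= N%:R.
  have : `|c i| <= \sum_i `|c i| by rewrite (bigD1 i) //= lerDl sumr_ge0.
  move/le_trans; apply; apply: ltW.
  have := @archi_boundP R (\sum_i `|c i|) _; rewrite sumr_ge0 // => /(_ isT) /lt_le_trans.
  by apply; rewrite ler_nat.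
exists (fun i => (if i \in T then N%:R else 0) + c i); split.
- move=> i; case: ifP => iT; last by rewrite cT ?iT ?addr0.
  by have := cN i; rewrite ler_norml => /andP[]; lra.
- by rewrite big_split /= cw -big_mkcond sumr_const mulr_natr.
- rewrite cu scaler_sumr big_mkcond -big_split; apply: eq_bigr => i _ /=.
  by rewrite scalerDl; case: ifP => _ //; rewrite scale0r.
Qed.

(* Downward induction on [T]: either the smallest face containing [T] contains a
   further vertex, or [T] consists of the vertices of a face, and the
   Nullstellensatz on the torus of this face expresses a multiple of the monomial
   through monomials off the face. *)
Lemma nilpotent_vertex_sum T : (0 < #|T|)%N ->
  nilpotent_mod #|T| (laurent_monom 1 (\sum_(t in T) V t)).
Proof.
have [k] := ubnP (#|I| - #|T|)%N; elim: k T => // k IH T Tk T_gt0.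
pose wt (S : {set I}) := \sum_(t in S) V t.
rewrite -/(wt T).
have IHv v : v \notin T -> exists2 k, (0 < k)%N &
    in_ideal (k * #|T|.+1).-1 (laurent_monom 1 ((wt T + V v) *+ k)).
  move=> vT; have cvT : #|v |: T| = #|T|.+1 by rewrite cardsU1 vT.
  have := IH (v |: T); rewrite cvT => /(_ _ isT)[|m m0].
    by have := max_card (mem (v |: T)); move: Tk; rewrite cvT; lia.
  rewrite laurent_monomX big_setU1 //= addrC => Im; exists m; first exact: m0.
  exact: Im.
have [t0 t0T] := card_gt0P T_gt0.
have wtR : real_point R (wt T) = \sum_(t in T) VR t by exact: real_point_sum.
have [[v [vT face]]|noface] := pselect (exists v, v \notin T /\
    forall l b, (forall i, b <= dot (VR i) l) ->
      (forall t, t \in T -> dot (VR t) l = b) -> dot (VR v) l = b).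
  (* A power of the monomial of [T] is divisible by that of [v]; one more factor makes it divisible
     by the monomial of [v |: T], nilpotent by induction. *)
  have [N Nin] := in_slice_face_closure t0T face.
  have [m m0 Im] := IHv v vT.
  have NT0 : (0 < N.+1 * #|T|)%N by rewrite muln_gt0.
  have Ns : lattice_slice (N.+1 * #|T| - 1) (wt T *+ N.+1 - V v).
    by rewrite /lattice_slice real_pointD real_pointN real_pointMn wtR natrB ?natrM.
  exists (m * N.+2)%N; first by rewrite muln_gt0 m0.
  have := in_ideal_monom Im (lattice_sliceMn m Ns).
  have -> : (wt T *+ N.+1 - V v) *+ m + (wt T + V v) *+ m = wt T *+ (m * N.+2).
    rewrite -mulrnDl [wt T + V v]addrC addrA subrK -mulrSr -mulrnA.
    by rewrite mulnC.
  have -> : (m * (N.+1 * #|T| - 1) + (m * #|T|.+1).-1 = (m * N.+2 * #|T|).-1)%N by nia.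
  by rewrite laurent_monomX.
have /choice[lv lvP] : forall v, exists lb : 'cV[R]_n * R, v \notin T ->
    [/\ forall i, lb.2 <= dot (VR i) lb.1,
        forall t, t \in T -> dot (VR t) lb.1 = lb.2 & lb.2 < dot (VR v) lb.1].
  move=> v; have [vT|vT] := boolP (v \in T); first by exists (0, 0).
  have /existsNP[l /existsNP[b /not_implyP[bV /not_implyP[bT bv]]]] :
    ~ forall l b, (forall i, b <= dot (VR i) l) ->
      (forall t, t \in T -> dot (VR t) l = b) -> dot (VR v) l = b.
    by move=> face; apply: noface; exists v.
  exists (l, b) => _; split=> //=; rewrite lt_def bV andbT.
  by apply/eqP.
(* Each summand is minimal on [T] and excludes one further point, so the sum is minimal exactly on
   [T]. *)
pose l := \sum_(v | v \notin T) (lv v).1; pose b := \sum_(v | v \notin T) (lv v).2.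
have bV i : b <= dot (VR i) l.
  by rewrite dot_sumr; apply: ler_sum => v vT; case: (lvP v vT).
have bT t : t \in T -> dot (VR t) l = b.
  by move=> tT; rewrite dot_sumr; apply: eq_bigr => v vT; case: (lvP v vT) => _ /(_ t tT).
have bN v : v \notin T -> b < dot (VR v) l.
  move=> vT; rewrite dot_sumr /b (bigD1 v) //= [X in _ < X](bigD1 v) //=.
  apply: ltr_leD; first by case: (lvP v vT).
  by apply: ler_sum => v' /andP[v'T _]; case: (lvP v' v'T).
pose A := [set x : 'rV[R]_n | dot x l = b]; pose G j := laurent_restrict A (F j).
have [a aG] : exists a, 1 = \sum_j a j * G j.
  by apply: torus_nullstellensatz; apply: no_zero => //; exists t0; exact: bT.
have suppG j : supported (G j) (affine_on T 1).
  move=> u; rewrite laurent_coef_restrict; case: asboolP => [uA /suppF[c [c0 c1 cu]]|]; last first.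
    by rewrite eqxx.
  exists c; split=> // i iT.
  have : \sum_i c i * (dot (VR i) l - b) == 0.
    under eq_bigr do rewrite mulrBr.
    rewrite sumrB -mulr_suml c1 mul1r subr_eq0 -[X in _ == X]uA cu dot_suml.
    by apply/eqP; apply: eq_bigr => j' _; rewrite dotZl.
  rewrite psumr_eq0 => [/allP/(_ i)|j' _]; last by rewrite mulr_ge0 // subr_ge0.
  rewrite mem_index_enum => /(_ isT); rewrite mulf_eq0 subr_eq0 => /orP[/eqP //|/eqP E].
  by have := bN i iT; rewrite E ltxx.
have /choice[a1 a1P] : forall j, exists a1, supported a1 (affine_on T (-1)) /\
    supported (a j - a1) (fun u => ~ affine_on T (-1) u).
  move=> j; have [a1 [a2 [aE s1 s2]]] := laurent_split (affine_on T (-1)) (a j).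
  exists a1; split; first by apply: supported_impl s1 => u [].
  by rewrite aE addrAC subrr add0r; apply: supported_impl s2 => u [].
have a1G : 1 = \sum_j a1 j * G j.
  have S1 : supported (\sum_j a1 j * G j) (affine_on T 0).
    apply: supported_sum => j; apply: supportedM (a1P j).1 (suppG j) _ => u v uT vT.
    by rewrite -[0](addNr (1 : R)); exact: affine_onD.
  have S2 : supported (\sum_j (a j - a1 j) * G j) (fun u => ~ affine_on T 0 u).
    apply: supported_sum => j; apply: supportedM (a1P j).2 (suppG j) _ => u v uT vT uvT.
    apply: uT; rewrite -[u](addrK v) -[-1]add0r; apply: affine_onD => //.
    exact: affine_onN.
  have E : 1 = \sum_j a1 j * G j + \sum_j (a j - a1 j) * G j.
    by rewrite -big_split aG; apply: eq_bigr => j _; rewrite mulrBl /= addrC subrK.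
  apply: laurent_ext => u; have [uT|uT] := pselect (affine_on T 0 u).
    rewrite [in LHS]E laurent_coefD [X in _ + X](_ : _ = 0) ?addr0 //.
    by apply/eqP; apply: contrapT => /negP /S2.
  rewrite [RHS](_ : _ = 0); last by apply/eqP; apply: contrapT => /negP /S1.
  rewrite laurent1E laurent_coef_monom; case: eqVneq => // u0; exfalso; apply: uT.
  rewrite -u0; exists (fun=> 0); split=> //; first by rewrite big1.
  by rewrite real_point0 big1 // => i _; rewrite scale0r.
have [|N0 N0P] := @uniform_shift (flatten [seq (msupp (a1 j) : seq _) | j <- enum J])
    (real_point R (wt T)) #|T| 1.
  move=> u /flatten_mapP[j _ ua]; have [||N1 N1P] := @affine_on_shift T (-1) u => //.
    by apply: (a1P j).1; rewrite -mem_laurent_supp.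
  by exists N1 => N /N1P; rewrite wtR.
pose N := N0.+1.
have NT0 : (0 < N * #|T|)%N by rewrite muln_gt0.
have a1N j u : laurent_coef (a1 j) u != 0 -> lattice_slice (N * #|T| - 1) (wt T *+ N + u).
  move=> ua; rewrite /lattice_slice real_pointD real_pointMn natrB ?natrM //.
  apply: N0P; first exact: leqnSn.
  by apply/flatten_mapP; exists j; rewrite ?mem_enum // mem_laurent_supp.
pose bj j := laurent_monom 1 (wt T *+ N) * a1 j.
have bjS j : supported (bj j) (lattice_slice (N * #|T| - 1)).
  apply: (supportedM (P := eq (wt T *+ N)) (Q := fun u => laurent_coef (a1 j) u != 0)).
  - by apply: supported_monom.
  - by move=> u.
  - by move=> _ u <-; exact: a1N.
pose d := (#|T| + (N * #|T| - 1)).+1.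
have dE : d = (N.+1 * #|T|)%N by rewrite /d mulSn -addnS; congr (_ + _)%N; lia.
have wbS j : supported (laurent_monom 1 (wt T) * bj j)
    (fun u => exists2 y, lattice_slice (N * #|T| - 1) y & u = wt T + y).
  apply: (supportedM (P := eq (wt T)) _ (bjS j)); first exact: supported_monom.
  by move=> _ y <- yS; exists y.
have wTs : lattice_slice #|T| (wt T) := lattice_slice_sum T.
(* The factor [wt T *+ N] makes the coefficients honest polynomials of degree [N * #|T| - 1]. The
   additional [wt T] serves [off_face], since the induction hypothesis concerns [wt T + V v]. *)
have expand : laurent_monom 1 (wt T *+ N.+1) =
    \sum_j (laurent_monom 1 (wt T) * bj j) * F j +
    \sum_j (laurent_monom 1 (wt T) * bj j) * (G j - F j).
  have E : laurent_monom 1 (wt T *+ N.+1) =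
      laurent_monom 1 (wt T) * laurent_monom (1 : L) (wt T *+ N).
    by rewrite laurent_monomM mulr1 mulrS.
  rewrite E; exact: (sum_replace (laurent_monom 1 (wt T)) (laurent_monom 1 (wt T *+ N)) F a1G).
have sGF j : supported (G j - F j) (fun u => lattice_slice 1 u /\ dot (real_point R u) l != b).
  move=> u; rewrite laurent_coefB laurent_coef_restrict; case: asboolP => [_|uA].
    by rewrite subrr eqxx.
  by rewrite sub0r oppr_eq0 => /suppF; split=> //; apply/eqP.
(* A point off the face has positive weight at some [v] outside [T], so a multiple of it contains
   [V v]; the same multiple of the whole exponent then contains [wt T + V v]. *)
have off_face y u : lattice_slice (N * #|T| - 1) y -> lattice_slice 1 u ->
    dot (real_point R u) l != b -> nilpotent_mod d (laurent_monom 1 (wt T + y + u)).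
  move=> yS [c [c0 + cu]] ub; rewrite mulr1n => c1.
  have [v vT cv] : exists2 v, v \notin T & 0 < c v.
    apply: contrapT => nov; move/eqP: ub; apply.
    rewrite cu dot_suml -[RHS]mul1r -c1 mulr_suml; apply: eq_bigr => i _.
    rewrite dotZl; have [iT|iT] := boolP (i \in T); first by rewrite bT.
    have [ci|ci] := ltP 0 (c i); first by exfalso; apply: nov; exists i.
    have -> : c i = 0 by apply/le_anti; rewrite ci c0.
    by rewrite !mul0r.
  pose M := Num.bound (c v)^-1.
  have Mc : 1 <= M%:R * c v.
    have := @archi_boundP R (c v)^-1 _; rewrite invr_ge0 c0 => /(_ isT) /ltW.
    have cv0 : c v != 0 by rewrite gt_eqF.
    by move=> H; rewrite -[X in X <= _](mulVf cv0) ler_pM2r.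
  have M0 : (0 < M)%N by rewrite lt0n; apply: contraTneq Mc => ->; rewrite mul0r -ltNge.
  have uvS : lattice_slice (M - 1) (u *+ M - V v).
    rewrite /lattice_slice real_pointD real_pointN real_pointMn natrB //.
    exists (fun i => M%:R * c i - (i == v)%:R); split.
    - move=> i; case: eqP => [->|_]; rewrite ?subr0 ?subr_ge0 //.
      by rewrite mulr_ge0.
    - rewrite sumrB -mulr_sumr c1 mulr1 (bigD1 v) //= eqxx big1 ?addr0 //.
      by move=> i /negPf->.
    - rewrite cu scaler_sumr; under [RHS]eq_bigr do rewrite scalerBl -scalerA.
      rewrite sumrB; congr (_ - _); rewrite (bigD1 v) //= eqxx scale1r big1 ?addr0 //.
      by move=> i /negPf->; rewrite scale0r.
  have [m m0 Im] := IHv v vT.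
  exists (m * M)%N; first by rewrite muln_gt0 m0.
  have S : lattice_slice ((M - 1) * #|T| + M * (N * #|T| - 1) + (M - 1))
      (wt T *+ (M - 1) + y *+ M + (u *+ M - V v)).
    by do 2![apply: lattice_sliceD => //]; exact: lattice_sliceMn.
  have := in_ideal_monom Im (lattice_sliceMn m S); rewrite -mulrnDl.
  have -> : wt T *+ (M - 1) + y *+ M + (u *+ M - V v) + (wt T + V v) = (wt T + y + u) *+ M.
    by rewrite subn1 -[in RHS](prednK M0) -{2 3}(prednK M0); exact: regroup_multiple.
  have -> : (m * ((M - 1) * #|T| + M * (N * #|T| - 1) + (M - 1)) + (m * #|T|.+1).-1
      = (m * M * d).-1)%N.
    rewrite dE mulSn -(prednK NT0) -(prednK M0) -(prednK m0) !subn1 /=.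
    exact: degree_count.
  by rewrite -mulrnA laurent_monomX [(M * m)%N]mulnC.
have wbF j (H : laurent L n) : supported H (lattice_slice 1) ->
    supported (laurent_monom 1 (wt T) * bj j * H) (lattice_slice d).
  move=> HS; apply: supportedM (wbS j) HS _ => _ v [y yS ->] vS.
  by rewrite /d -addn1; do 2![apply: lattice_sliceD => //].
have : nilpotent_mod d (laurent_monom 1 (wt T *+ N.+1)).
  rewrite expand; apply: nilpotent_modD => //.
  - by apply: supported_sum => j; exact: wbF.
  - by apply: supported_sum => j; apply: wbF => u /sGF[].
  - exists 1%N; first exact: isT.
    rewrite expr1 mul1n /d.
    exists (fun j => laurent_monom 1 (wt T) * bj j); split; last exact: erefl.
    move=> j.
    by apply: supported_impl (wbS j) => _ [y yS ->]; exact: lattice_sliceD.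
  - apply: nilpotent_mod_sum => //; apply: supported_sum => j.
    apply: supportedM (wbS j) (sGF j) _ => _ v [y yS ->] [vS vb].
    split; last exact: (off_face y v yS vS vb).
    by rewrite /d -addn1; do 2![apply: lattice_sliceD => //].
case=> m m0 Im; exists (m * N.+1)%N; first by rewrite muln_gt0 m0.
by move: Im; rewrite -mulnA -dE !laurent_monomX -mulrnA [(N.+1 * m)%N]mulnC.
Qed.

End Nilpotency.

(** * Exactness of the Cech complex *)

Section LaurentCech.
Variables (R : realType) (n : nat) (I : finType) (V : I -> 'rV[int]_n).
Local Notation VR := (fun i => real_point R (V i)).
Local Notation W := (codom V).
Implicit Types (s : seq bool) (u v : 'rV[int]_n) (l : 'cV[R]_n).

(* Exponents of the degree [d] part of the localisation of the graded ring of the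
   polytope at the points marked by [s]. *)
Definition good s (d : int) u := forall l b,
  (forall v, v \in W -> b <= dot (real_point R v) l) ->
  (forall v, v \in mask s W -> dot (real_point R v) l = b) ->
  d%:~R * b <= dot (real_point R u) l.

Lemma goodD s d e u v : good s d u -> good s e v -> good s (d + e) (u + v).
Proof.
move=> gu gv l b bW bs; rewrite real_pointD dotDl rmorphD mulrDl.
by apply: lerD; [exact: gu | exact: gv].
Qed.

Lemma good_subbits s t d u : subbits t s -> good t d u -> good s d u.
Proof. by move=> ts gu l b bW bs; apply: gu => // v /(mask_subbits ts); exact: bs. Qed.

Lemma lattice_slice_good s (d : nat) u : lattice_slice R V d u -> good s d u.
Proof.
by move=> du l b bW bs; apply: (in_slice_dual du) => i; apply: bW; exact: codom_f.
Qed.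

Lemma good_lattice_slice (d : nat) u :
  good (nseq #|I| false) d u -> lattice_slice R V d u.
Proof.
move=> gu; apply: in_sliceP => l b bV; apply: gu => [v /codomP[i ->]|v]; first exact: bV.
by rewrite mask_false.
Qed.

(** Allowing any lower bound [b], not just the minimum, makes the convexity of this set of
    functionals evident. A lower bound can be raised to the minimum because [d] is non-negative. *)
Lemma realised_good s (d : nat) u :
  realised (fun v l => dot (real_point R v) l)
    (fun l => exists2 b, forall v, v \in W -> b <= dot (real_point R v) l
                       & dot (real_point R u) l < d%:R * b) W s <-> ~ good s d u.
Proof.
split.
  case=> l [b bW bu] ls gu.
  have [s0|] := boolP (mask s W == [::]).
    have : d%:R * b <= dot (real_point R u) l.
      by apply: gu => // v; rewrite (eqP s0).
    by rewrite leNgt bu.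
  case ms: (mask s W) => [//|g m] _.
  have gs : g \in mask s W by rewrite ms mem_head.
  have : d%:R * dot (real_point R g) l <= dot (real_point R u) l.
    apply: gu => [v|v vs]; first exact: ls.
    by apply/le_anti; rewrite !ls // (mem_mask gs, mem_mask vs).
  rewrite leNgt => /negP; apply.
  by rewrite (lt_le_trans bu) // ler_wpM2l // bW // (mem_mask gs).
move=> /existsNP[l /existsNP[b /not_implyP[bW /not_implyP[bs /negP]]]].
rewrite -ltNge => bu; exists l; first by exists b.
by move=> g v gs vW; rewrite (bs g gs) bW.
Qed.

(** The complex splits over the exponents [u], and for each of them the support condition says that
    the coefficients vanish on the nerve of the cover. *)
Lemma laurent_cech_exact (L : comNzRingType) (d : nat) (c : seq bool -> laurent L n) :
  (0 < #|I|)%N ->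
  (forall s, size s = #|I| -> supported (c s) (good s d)) ->
  (forall s, size s = #|I| -> cob c s = 0) ->
  exists2 b : seq bool -> laurent L n,
    forall s, size s = #|I| -> supported (b s) (good s d) &
    forall s, size s = #|I| -> cob b s = c s.
Proof.
move=> I0 cS dc.
have coef_cob (e : seq bool -> laurent L n) s u :
    laurent_coef (cob e s) u = cob (fun t => laurent_coef (e t) u) s.
  apply: (cob_morph (phi := fun h : laurent L n => laurent_coef h u)).
    exact: laurent_coef0.
  by move=> x y; exact: laurent_coefB.
pose U u l := exists2 b, forall v, v \in W -> b <= dot (real_point R v) l
                       & dot (real_point R u) l < d%:R * b.
have cU u : convex_pred (U u).
  move=> l l' t /andP[t0 t1] [b bW bu] [b' bW' bu'].
  exists ((1 - t) * b + t * b') => [v vW|].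
    rewrite dotDr !dotZr; apply: lerD; apply: ler_wpM2l; rewrite ?subr_ge0 //.
      exact: bW.
    exact: bW'.
  rewrite dotDr !dotZr mulrDr !(mulrCA d%:R).
  have [->|tn0] := eqVneq t 0; first by rewrite subr0 !mul1r !mul0r !addr0.
  apply: ler_ltD; first by rewrite ler_wpM2l ?subr_ge0 // ltW.
  by rewrite ltr_pM2l // lt_def tn0.
have evA v (l l' : 'cV[R]_n) (t : R) : dot (real_point R v) ((1 - t) *: l + t *: l') =
    (1 - t) * dot (real_point R v) l + t * dot (real_point R v) l'.
  by rewrite dotDr !dotZr.
have szW : size W = #|I| by rewrite size_codom.
have /choice[bu buP] : forall u, exists b : seq bool -> L,
    (forall s, size s = #|I| -> b s != 0 -> good s d u) /\
    (forall s, size s = #|I| -> cob b s = laurent_coef (c s) u).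
  move=> u.
  have [|||b ob db] := convex_cover_acyclic (ev := fun v l => dot (real_point R v) l)
    evA (c := fun s => laurent_coef (c s) u) (cU u) (W := W).
  - by rewrite szW.
  - move=> s; rewrite szW => ss cs; apply/realised_good => gu; apply: gu.
    exact: (cS s ss u cs).
  - by move=> s; rewrite szW => ss; rewrite -coef_cob dc // laurent_coef0.
  rewrite szW in db; exists b; split=> // s ss bs.
  by apply: contrapT => ng; apply: (ob s (etrans ss (esym szW)) bs); apply: (realised_good s d u).2.
(* Only finitely many exponents occur in [c]; outside them the primitive is taken to be 0, so the
   coefficients assemble to Laurent polynomials. *)
pose E := undup (flatten [seq (msupp (c (tval t)) : seq _) | t <- enum {: #|I|.-tuple bool}]).
have cE s u : size s = #|I| -> u \notin E -> laurent_coef (c s) u = 0.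
  move=> ss; rewrite mem_undup => uE; apply/eqP; apply: contraNT uE => cu.
  apply/flatten_mapP; exists (tcast ss (in_tuple s)); first by rewrite mem_enum.
  by rewrite val_tcast mem_laurent_supp.
pose b s := \sum_(u <- E) laurent_monom (bu u s) u.
have bE s u : laurent_coef (b s) u = if u \in E then bu u s else 0.
  rewrite laurent_coef_sum; under eq_bigr do rewrite laurent_coef_monom.
  case: ifP => uE.
    rewrite (bigD1_seq u) ?undup_uniq //= eqxx mulr1n big1 ?addr0 // => v /negPf->.
    by [].
  rewrite big_seq big1 // => v vE; case: eqVneq => // vu.
  by rewrite -vu vE in uE.
exists b => [s ss u|s ss].
  by rewrite bE; case: ifP => [_|]; rewrite ?eqxx //; apply: (buP u).1.
apply: laurent_ext => u; rewrite coef_cob.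
have [uE|uE] := boolP (u \in E).
  rewrite -(buP u).2 //; apply: eq_cob => t _.
  by rewrite bE uE.
rewrite cE // -(cob0 L s); apply: eq_cob => t _.
by rewrite bE (negPf uE).
Qed.

End LaurentCech.

Lemma sum_mul_nth (B : comNzRingType) q (a F : 'I_q.+1 -> B) (c p : B) :
  c * p = 1 -> p = \sum_j a j * F j ->
  \sum_(i < q.+1) [seq c * a j | j <- enum 'I_q.+1]`_i * [seq F j | j <- enum 'I_q.+1]`_i = 1.
Proof.
move=> <- ->; rewrite mulr_sumr; apply: eq_bigr => j _.
have nE (G : 'I_q.+1 -> B) : [seq G i | i <- enum 'I_q.+1]`_j = G j.
  by rewrite (nth_map ord0) ?size_enum_ord // nth_ord_enum.
by rewrite !nE mulrA.
Qed.

Section MonomialsInIdeal.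
Variables (R : realType) (n : nat) (I : finType) (V : I -> 'rV[int]_n).
Variables (L : closedFieldType) (q : nat) (F : 'I_q.+1 -> laurent L n).
Local Notation VR := (fun i => real_point R (V i)).
Hypotheses (I_gt0 : (0 < #|I|)%N)
  (suppF : forall j, supported (F j) (lattice_slice R V 1))
  (no_zero : forall (l : 'cV[R]_n) b, (forall i, b <= dot (VR i) l) ->
     (exists i, dot (VR i) l = b) ->
     ~ exists z : 'rV[L]_n, (forall j, z 0 j != 0) /\
      forall j, laurent_eval idfun z (laurent_restrict [set x | dot x l = b] (F j)) = 0).

Lemma monomial_in_ideal w : lattice_slice R V q.+1 w ->
  in_ideal R V F q (laurent_monom 1 w).
Proof.
move=> wS.
pose f := [seq F j | j <- enum 'I_q.+1].
have fE (i : 'I_q.+1) : f`_i = F i.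
  by rewrite (nth_map ord0) ?size_enum_ord // nth_ord_enum.
have sf : size f = q.+1 by rewrite size_map size_enum_ord.
have unit_vertex s : size s = #|I| -> has id s -> exists e : seq (laurent L n),
    [/\ size e = q.+1, forall i, supported e`_i (good R V s (-1))
      & \sum_(i < q.+1) e`_i * f`_i = 1].
  move=> ss hs.
  have [v vs] : exists v, v \in mask s (codom V).
    have : size (mask s (codom V)) != 0%N.
      by rewrite size_mask ?size_codom // -lt0n -has_count.
    by case: (mask _ _) => [//|v m] _; exists v; rewrite mem_head.
  have /codomP[i vE] := mem_mask vs.
  have [k k0 [a [aS aE]]] := nilpotent_vertex_sum suppF no_zero (T := [set i])
    (eq_leq (esym (cards1 i))).
  rewrite big_set1 cards1 muln1 -vE in aS aE.
  (* Division by the [k]-th power of the vertex monomial brings coefficients of degree [k.-1] to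
     degree -1. *)
  exists [seq laurent_monom 1 (- (v *+ k)) * a j | j <- enum 'I_q.+1]; split.
  - by rewrite size_map size_enum_ord.
  - move=> m; have [mq|mq] := ltnP m q.+1; last first.
      rewrite nth_default; last by rewrite size_map size_enum_ord.
      exact: supported0.
    rewrite (nth_map ord0) ?size_enum_ord //.
    have monS : supported (laurent_monom (1 : L) (- (v *+ k))) (eq (- (v *+ k))).
      by apply: supported_monom.
    apply: supportedM monS (aS _) _ => _ y <- yS l b bW bs.
    have yb : (k.-1)%:R * b <= dot (real_point R y) l.
      by apply: (in_slice_dual yS) => j; apply: bW; exact: codom_f.
    rewrite real_pointD real_pointN real_pointMn dotDl -scaleNr dotZl (bs v vs).
    have kE : k%:R = (k.-1)%:R + 1 :> R by rewrite -[in LHS](prednK k0) -natr1.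
    by rewrite kE rmorphN /=; lra.
  - apply: (sum_mul_nth (p := laurent_monom 1 v ^+ k)); last exact: aE.
    rewrite laurent_monomX laurent_monomM mulr1 addNr.
    exact: esym (laurent1E _ _).
have DN s d (h1 h2 : laurent L n) : supported h1 (good R V s d) ->
    supported h2 (good R V s d) -> supported (h1 - h2) (good R V s d).
  exact: supportedB.
have [||||||||h [hS hE]] := @double_complex_surjective (laurent L n)
  (fun s d h => supported h (good R V s d)) _ _ _ _ #|I| q.+1 f _ sf _ unit_vertex _
  (laurent_monom 1 w).
- by move=> s d; exact: supported0.
- exact: DN.
- by move=> s d e a b aS bS; apply: supportedM aS bS _ => u v; exact: goodD.
- move=> s t d a ts aS; apply: supported_impl aS => u.
  exact: good_subbits ts.
- exact: I_gt0.
- move=> s i; have [iq|iq] := ltnP i q.+1; last first.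
    rewrite nth_default; last by rewrite sf.
    exact: supported0.
  rewrite (fE (Ordinal iq)) => u /suppF.
  exact: (@lattice_slice_good _ _ _ _ s 1).
- by move=> d c; exact: laurent_cech_exact.
- by apply: supported_monom => _; exact: lattice_slice_good.
exists h; split=> [j|].
  apply: supported_impl (hS j) => u; have -> : q.+1%:Z - 1 = q%:Z by lia.
  exact: good_lattice_slice.
by rewrite hE; apply: eq_bigr => j _; rewrite fE.
Qed.

End MonomialsInIdeal.

(** * Descent to the local ring *)

(** In the valuation ring case a non-zero non-unit lies in a maximal ideal, which is the unique
    non-zero one and hence [m]. *)
Lemma local_unit (K : idomainType) (m : idealr K) :
  is_field K \/ is_dvr K -> maximal_ideal m -> forall x, x \notin m -> x \is a GRing.unit.
Proof.
case=> [fieldK|[_ [I [Imax [x0 x0I x00] Iuniq]]]] mmax x xm.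
  by apply: fieldK; apply: contraNneq xm => ->; exact: idealr0.
apply: contrapT => /negP nx.
have x_neq0 : x != 0 by apply: contraNneq xm => ->; exact: idealr0.
pose X (a : K) := exists b, a = b * x.
have idX : ideal_pred X.
  split; first by exists 0; rewrite mul0r.
    by move=> _ _ [b ->] [c ->]; exists (b + c); rewrite mulrDl.
  by move=> a _ [b ->]; exists (a * b); rewrite mulrA.
have X1 : ~ X 1.
  by case=> b bx; apply: (negP nx); apply/unitrPr; exists b; rewrite mulrC.
have [P [XP [P0 PD PM] P1 Pmax]] := maximal_ideal_exists idX X1.
have Jc : idealr_closed (fun a => `[< P a >]).
  split; rewrite ?unfold_in /=; [exact/asboolP|exact/asboolP|].
  move=> a u v; rewrite !unfold_in => /asboolP Pu /asboolP Pv; apply/asboolP.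
  by apply: PD => //; exact: PM.
pose J : idealr K := HB.pack (fun a : K => `[< P a >]) (isIdealr.Build K _ Jc).
have JP a : (a \in J) = `[< P a >] by [].
have Jmax : maximal_ideal J.
  move=> J' JJ' a aJ'; rewrite JP; apply/asboolP; apply: contrapT => nPa.
  have [b [c [Pc bc]]] := Pmax a nPa.
  have cJ' : c \in J' by apply: JJ'; rewrite JP; exact/asboolP.
  have : 1 \in J' by rewrite -bc rpredD // idealMr.
  by rewrite idealr1.
have xJ : x \in J by rewrite JP; apply/asboolP; apply: XP; exists 1; rewrite mul1r.
have JI := Iuniq J Jmax (ex_intro2 _ _ x xJ x_neq0).
(* Were [m] zero, it would be contained in [I], and its maximality would make [I] zero too. *)
have [y ym y0] : exists2 y, y \in m & y != 0.
  apply: contrapT => nom; move: x0I; apply/negP.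
  have m0 y : y \in m -> y = 0.
    by move=> ym; apply/eqP; apply: contrapT => /negP y0; apply: nom; exists y.
  apply: contraNN x00 => x0I; apply/eqP/m0/(mmax I) => // y ym.
  by rewrite (m0 y ym) idealr0.
have mI := Iuniq m mmax (ex_intro2 _ _ y ym y0).
by move: xm; rewrite mI -JI xJ.
Qed.

(** The determinant of the chosen rows is formed in [K] and only tested in [L], so [psi] may have
    any image, in particular one much smaller than [L]. *)
Lemma lift_surjectivity (K : comUnitRingType) (L : fieldType) (psi : {rmorphism K -> L})
    (A C : finType) (M : A -> C -> K) :
  (forall x, psi x != 0 -> x \is a GRing.unit) ->
  (forall c, exists y : A -> L, forall c', \sum_a y a * psi (M a c') = (c == c')%:R) ->
  forall g : C -> K, exists x : A -> K, forall c, \sum_a x a * M a c = g c.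
Proof.
move=> psi_unit /choice[Y YE] g.
pose N : 'M[K]_(#|A|, #|C|) := \matrix_(i, j) M (enum_val i) (enum_val j).
have full : row_full (map_mx psi N).
  apply/row_fullP; exists (\matrix_(i, j) Y (enum_val i) (enum_val j)).
  apply/matrixP => i j; rewrite !mxE.
  under eq_bigr do rewrite !mxE.
  transitivity (\sum_a Y (enum_val i) a * psi (M a (enum_val j))); last first.
    by rewrite YE (inj_eq enum_val_inj).
  by rewrite (reindex (@enum_val A A)) //=; apply: onW_bij; exact: enum_val_bij.
pose S := rowsub (fullrankfun full) N.
have Sunit : S \in unitmx.
  rewrite unitmxE; apply: psi_unit; rewrite -det_map_mx.
  have := fullrowsub_unit full; rewrite unitmxE unitfE.
  by rewrite /S map_mxsub.
pose X := (\row_j g (enum_val j)) *m invmx S *m rowsub (fullrankfun full) 1%:M.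
have XN : X *m N = \row_j g (enum_val j).
  by rewrite /X -mulmxA mul_rowsub_mx mul1mx mulmxKV.
exists (fun a => X 0 (enum_rank a)) => c.
have := congr1 (fun u : 'rV_#|C| => u 0 (enum_rank c)) XN; rewrite !mxE enum_rankK => <-.
rewrite (reindex (@enum_val A A)) /=; last by apply: onW_bij; exact: enum_val_bij.
apply: eq_bigr => i _; rewrite enum_valK; congr (_ * _).
by rewrite ?mxE ?enum_rankK.
Qed.

(** * Vertices of polytopes *)

Section FinitelyGeneratedHull.
Variables (R : realType) (n : nat).
Implicit Types (s : seq 'rV[R]_n) (x y : 'rV[R]_n) (A : set 'rV[R]_n) (t : R).

Definition hull s y := exists c : 'rV[R]_n -> R,
  [/\ forall v, 0 <= c v, \sum_(v <- s) c v = 1 & y = \sum_(v <- s) c v *: v].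

Lemma convex_setP A : @convex_set R 'rV[R]_n A <->
  forall x y t, 0 <= t -> t <= 1 -> A x -> A y -> A (t *: x + (1 - t) *: y).
Proof.
split=> [cA x y t t0 t1 Ax Ay|cA x y t].
  by have := cA x y (Itv01 t0 t1) (mem_set Ax) (mem_set Ay) => /set_mem.
by move=> /set_mem Ax /set_mem Ay; apply: mem_set; apply: cA.
Qed.

(** Weights are not normalised, since the tail of a list of weights with sum 1 has another sum,
    possibly 0. *)
Lemma convex_comb A s (c : 'rV[R]_n -> R) : @convex_set R 'rV[R]_n A ->
  (forall v, v \in s -> A v) -> (forall v, 0 <= c v) -> 0 < \sum_(v <- s) c v ->
  A ((\sum_(v <- s) c v)^-1 *: \sum_(v <- s) c v *: v).
Proof.
move=> /convex_setP cA sA c0; elim: s sA => [|v s IH] sA; first by rewrite big_nil ltxx.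
have vA : A v by apply: sA; rewrite mem_head.
have {}IH := IH (fun w ws => sA w (mem_behead (s := v :: s) ws)).
have S0 : 0 <= \sum_(w <- s) c w by rewrite sumr_ge0.
rewrite !big_cons; move: S0; rewrite le_eqVlt => /orP[/eqP S0|S0].
  rewrite -S0 addr0 => cv; have -> : \sum_(w <- s) c w *: w = 0.
    rewrite big_seq big1 // => w ws; have : \sum_(w <- s) c w == 0 by rewrite -S0.
    by rewrite psumr_eq0 // => /allP/(_ w ws)/eqP->; rewrite scale0r.
  by rewrite addr0 scalerA mulVf ?scale1r // gt_eqF.
move=> cS; set S := \sum_(w <- s) c w in S0 IH cS *.
have t0 : 0 <= c v / (c v + S) by rewrite divr_ge0 // ltW.
have t1 : c v / (c v + S) <= 1 by rewrite ler_pdivrMr // mul1r lerDl ltW.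
have := cA _ _ _ t0 t1 vA (IH S0).
suff -> : c v / (c v + S) *: v + (1 - c v / (c v + S)) *: (S^-1 *: \sum_(w <- s) c w *: w)
   = (c v + S)^-1 *: (c v *: v + \sum_(w <- s) c w *: w) by [].
rewrite scalerDr !scalerA mulrC; congr (_ + _ *: _).
by field; rewrite !gt_eqF.
Qed.

Lemma hull_convex s : @convex_set R 'rV[R]_n (hull s).
Proof.
apply/convex_setP => _ _ t t0 t1 [c [c0 c1 ->]] [e [e0 e1 ->]].
exists (fun v => t * c v + (1 - t) * e v); split.
- by move=> v; rewrite addr_ge0 // mulr_ge0 // subr_ge0.
- by rewrite big_split /= -!mulr_sumr c1 e1; ring.
- rewrite !scaler_sumr -big_split; apply: eq_bigr => v _ /=.
  by rewrite [RHS]scalerDl !scalerA.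
Qed.

Lemma hull_mem s v : uniq s -> v \in s -> hull s v.
Proof.
move=> us vs; exists (fun w => (w == v)%:R); split.
- by move=> w; exact: ler0n.
- rewrite (bigD1_seq v) //= eqxx big1 ?addr0 // => w /negPf->.
  by [].
- rewrite (bigD1_seq v) //= eqxx scale1r big1 ?addr0 // => w /negPf->.
  by rewrite scale0r.
Qed.

Lemma hull_sub s A : @convex_set R 'rV[R]_n A -> (forall v, v \in s -> A v) ->
  hull s `<=` A.
Proof.
move=> cA sA _ [c [c0 c1 ->]].
by have := convex_comb cA sA c0; rewrite c1 ltr01 invr1 scale1r; apply.
Qed.

Lemma smallest_hull s : uniq s ->
  smallest (@convex_set R 'rV[R]_n) [set` s] = hull s.
Proof.
move=> us; apply/seteqP; split.
  apply: smallest_sub; first exact: hull_convex.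
  by move=> v /=; exact: hull_mem.
move=> y hy A [cA sA]; exact: (hull_sub cA sA hy).
Qed.

Lemma in_slice_hull s y : uniq s ->
  in_slice (fun i : 'I_(size s) => s`_i) 1 y <-> hull s y.
Proof.
move=> us; split.
  case=> c [c0 c1 yE]; pose e v := if insub (index v s) is Some i then c i else 0.
  have eE (i : 'I_(size s)) : e s`_i = c i by rewrite /e index_uniq // valK.
  exists e; split.
  - by move=> v; rewrite /e; case: insubP.
  - by rewrite (big_nth 0) big_mkord; under eq_bigr do rewrite eE.
  - by rewrite (big_nth 0) big_mkord; under eq_bigr do rewrite eE.
case=> c [c0 c1 yE]; exists (fun i : 'I_(size s) => c s`_i); split=> //.
  by rewrite -c1 (big_nth 0) big_mkord.
by rewrite yE (big_nth 0) big_mkord.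
Qed.

Lemma hull_rem s v : uniq s -> v \in s -> hull (rem v s) v -> hull s `<=` hull (rem v s).
Proof.
move=> us vs [e [e0 e1 vE]] _ [c [c0 c1 ->]].
exists (fun w => c w + c v * e w); split.
- by move=> w; rewrite addr_ge0 // mulr_ge0.
- rewrite big_split /= -mulr_sumr e1 mulr1 addrC.
  by rewrite -c1 [RHS](perm_big _ (perm_to_rem vs)) big_cons.
- rewrite (perm_big _ (perm_to_rem vs)) big_cons /= addrC.
  have -> : c v *: v = \sum_(w <- rem v s) c v *: (e w *: w) by rewrite -scaler_sumr -vE.
  rewrite -big_split; apply: eq_bigr => w _ /=.
  by rewrite [RHS]scalerDl scalerA.
Qed.

(* A generating set of minimal size consists of vertices: a functional separating
   one of its points from the hull of the others exposes this point. *)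
Lemma polytope_vertices (Gamma : set 'rV[R]_n) : polytope Gamma ->
  exists r (W : 'I_r.+1 -> 'rV[R]_n), (forall i, vertex Gamma (W i)) /\
    forall y, Gamma y <-> in_slice W 1 y.
Proof.
case=> s0 s0n GE.
pose gen s := [/\ uniq s, forall v, v \in s -> Gamma v & Gamma `<=` hull s].
pose Q k := `[< exists2 s, gen s & size s = k >].
have GE' : Gamma = smallest (@convex_set R 'rV[R]_n) [set` undup s0].
  by rewrite GE; congr smallest; apply/seteqP; split=> v /=; rewrite mem_undup.
have cG : @convex_set R 'rV[R]_n Gamma.
  by rewrite GE' smallest_hull ?undup_uniq //; exact: hull_convex.
have [x0 Gx0] : exists x, Gamma x.
  case: s0 s0n GE {GE'} => // x s _ ->; exists x; apply: sub_gen_smallest => /=.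
  exact: mem_head.
have exQ : exists k, Q k.
  exists (size (undup s0)); apply/asboolP; exists (undup s0) => //.
  split; rewrite ?undup_uniq //; last by rewrite GE' smallest_hull ?undup_uniq.
  by move=> v vs; rewrite GE'; exact: sub_gen_smallest.
case: (ex_minnP exQ) => k /asboolP[s [us sG Gs] sk] kmin.
have s_gt0 : (0 < size s)%N.
  by have [c [_ + _]] := Gs x0 Gx0; case: (s) => // /eqP; rewrite big_nil eq_sym oner_eq0.
have vert v : v \in s -> vertex Gamma v.
  move=> vs.
  (* Otherwise [v] could be dropped from the generators, against minimality. *)
  have nh : ~ hull (rem v s) v.
    move=> hv; have : Q (size (rem v s)).
      apply/asboolP; exists (rem v s) => //; split; first exact: rem_uniq.
        by move=> w /mem_rem; exact: sG.
      by move=> y /Gs; exact: hull_rem.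
    by move=> /kmin; rewrite size_rem // -sk; move: s_gt0; case: (size s) => // m _; rewrite ltnn.
  have [l [b [bs bv]]] : exists l b, (forall w, w \in rem v s -> b <= dot w l) /\ dot v l < b.
    apply: contrapT => no; apply: nh; apply/in_slice_hull; first exact: rem_uniq.
    apply: in_sliceP => l b bV; rewrite mul1r leNgt; apply/negP => vb; apply: no.
    by exists l, b; split=> // w /(nthP 0)[i iw <-]; exact: (bV (Ordinal iw)).
  have dpos w : w \in s -> w != v -> 0 < dot w l - dot v l.
    move=> ws wv; rewrite subr_gt0 (lt_le_trans bv) // bs //.
    by rewrite mem_rem_uniq // inE wv.
  have GyE y : Gamma y -> exists c, [/\ forall w, 0 <= c w,
      dot y l - dot v l = \sum_(w <- s) c w * (dot w l - dot v l) &
      y - v = \sum_(w <- s) c w *: (w - v)].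
    move=> /Gs[c [c0 c1 yE]]; exists c; split=> //.
      under eq_bigr do rewrite mulrBr.
      rewrite sumrB -mulr_suml c1 mul1r yE dot_suml.
      by under eq_bigr do rewrite dotZl.
    under eq_bigr do rewrite scalerBr.
    by rewrite sumrB -scaler_suml c1 scale1r yE.
  have tpos c w : (forall w, 0 <= c w) -> w \in s -> 0 <= c w * (dot w l - dot v l).
    move=> c0 ws; rewrite mulr_ge0 //; have [->|wv] := eqVneq w v; first by rewrite subrr.
    by rewrite ltW // dpos.
  split; first by exists v.
  (* A [face] maximises its functional whereas [l] is minimal at [v], hence the signs. *)
  exists (- l), (- dot v l).
  have dotN y : (y *m - l) 0 0 = - dot y l by rewrite mulmxN mxE.
  split=> [y /GyE[c [c0 E _]]|].
    by rewrite dotN lerN2 -subr_ge0 E big_seq sumr_ge0 // => w; exact: tpos.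
  apply/seteqP; split=> [_ ->|y [/GyE[c [c0 E yE]]]] /=.
    by split; [exact: sG | rewrite dotN].
  rewrite dotN => /eqP; rewrite eqr_opp => /eqP dE; move: E; rewrite dE subrr => /esym/eqP.
  rewrite big_seq psumr_eq0 => [/allP c00|w]; last exact: tpos.
  apply/eqP; rewrite -subr_eq0 yE big_seq big1 // => w ws.
  have := c00 w ws; rewrite ws mulf_eq0; have [->|wv] := eqVneq w v.
    by rewrite [v - v]subrr scaler0.
  by rewrite [X in _ || X]gt_eqF ?dpos // orbF => /eqP->; rewrite scale0r.
have [r rE] : exists r, size s = r.+1 by exists (size s).-1; rewrite prednK.
exists r, (fun i : 'I_r.+1 => s`_i); split=> [i|y]; first by apply: vert; rewrite mem_nth // rE.
have := in_slice_hull y us; rewrite rE => ->.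
by split=> [/Gs //|]; exact: hull_sub.
Qed.

End FinitelyGeneratedHull.

(** * The theorem *)

(** The slice lies in a box of radius [B], whose points are coded by ordinals shifted by [B]. *)
Lemma finite_lattice_slice (R : realType) n (I : finType) (V : I -> 'rV[int]_n) d :
  exists2 E : seq 'rV[int]_n, uniq E & forall u, u \in E <-> lattice_slice R V d u.
Proof.
pose B := (d * \sum_i \sum_j `|V i 0%R j|)%N.
have bound u j : lattice_slice R V d u -> (`|u 0%R j| <= B)%N.
  case=> c [c0 cd uE]; rewrite -(ler_nat R) natr_absz intr_norm.
  have -> : (u 0 j)%:~R = (\sum_i c i *: real_point R (V i)) 0 j by rewrite -uE mxE.
  rewrite summxE (le_trans (ler_norm_sum _ _ _)) // /B natrM -cd mulr_suml.
  apply: ler_sum => i _; rewrite !mxE normrM ger0_norm // ler_wpM2l //.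
  rewrite -intr_norm -natr_absz ler_nat (bigD1 i) //= (bigD1 j) //=.
  by rewrite -addnA leq_addr.
pose row_of (t : {ffun 'I_n -> 'I_(B + B).+1}) : 'rV[int]_n := \row_j ((t j)%:Z - B%:Z).
exists (undup [seq u <- [seq row_of t | t : {ffun 'I_n -> 'I_(B + B).+1}] |
    `[< lattice_slice R V d u >]]) => [|u]; first exact: undup_uniq.
rewrite mem_undup mem_filter; split=> [/andP[/asboolP //]|uS].
apply/andP; split; first exact/asboolP.
apply/mapP; exists [ffun j => inord (absz (u 0 j + B%:Z))]; first by rewrite mem_enum.
have shift (k : int) (b : nat) : (absz k <= b)%N ->
    k = (absz (k + b%:Z))%:Z - b%:Z /\ (absz (k + b%:Z)%R < (b + b).+1)%N by lia.
apply/rowP => j; rewrite !mxE ffunE.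
by have [kE kb] := shift _ _ (bound u j uS); rewrite inordK.
Qed.

Lemma laurent_coef_map (K K' : comNzRingType) n (phi : K -> K') (f : laurent K n) u :
  phi 0 = 0 -> laurent_coef (laurent_map phi f) u = phi (laurent_coef f u).
Proof.
move=> phi0; rewrite laurent_coef_sum.
under eq_bigr do rewrite laurent_coef_monom.
have [uf|uf] := boolP (u \in msupp f).
  rewrite (big_fsetD1 u) //= eqxx mulr1n big1_seq ?addr0 //.
  by move=> v /andP[_]; rewrite !inE => /andP[/negPf-> _].
have -> : laurent_coef f u = 0 by apply/eqP; rewrite -[_ == _]negbK -mem_laurent_supp.
rewrite phi0 big_seq big1 // => v vf; case: eqVneq => // vu.
by rewrite -vu vf in uf.
Qed.

Lemma laurent_evalE (K : comNzRingType) n (L : fieldType) (phi : K -> L) (z : 'rV[L]_n)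
    (f : laurent K n) (D : {fset 'rV[int]_n}) :
  phi 0 = 0 -> (forall u, laurent_coef f u != 0 -> u \in D) ->
  laurent_eval phi z f = \sum_(u <- D) phi (laurent_coef f u) * \prod_(j < n) z 0 j ^ u 0 j.
Proof.
move=> phi0 fD; apply: big_fset_incl => [|u uD].
  by apply/fsubsetP => u; rewrite mem_laurent_supp; exact: fD.
rewrite mem_laurent_supp negbK => /eqP->.
by rewrite phi0 mul0r.
Qed.

Lemma laurent_coef_monomM (K : comNzRingType) n (a : K) u (f : laurent K n) v :
  laurent_coef (laurent_monom a u * f) v = a * laurent_coef f (v - u).
Proof.
rewrite {1}[f]laurent_monomE mulr_sumr laurent_coef_sum.
rewrite [X in laurent_coef X (v - u)]laurent_monomE laurent_coef_sum mulr_sumr.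
apply: eq_bigr => w _; rewrite laurent_monomM !laurent_coef_monom mulrnAr.
by rewrite [w == _]eq_sym subr_eq eq_sym addrC.
Qed.

Lemma laurent_sum_nth (K : comNzRingType) n (E : seq 'rV[int]_n) (P : 'rV[int]_n -> Prop)
    (h : laurent K n) : uniq E -> (forall u, P u -> u \in E) -> supported h P ->
  h = \sum_(k < size E) laurent_monom (laurent_coef h E`_k) E`_k.
Proof.
move=> uE PE hP; apply: laurent_ext => u; rewrite laurent_coef_sum.
rewrite -(big_mkord xpredT (fun k => laurent_coef (laurent_monom (laurent_coef h E`_k) E`_k) u)).
rewrite -(big_nth 0 xpredT (fun v => laurent_coef (laurent_monom (laurent_coef h v) v) u)).
under eq_bigr do rewrite laurent_coef_monom.
have [uE'|uE'] := boolP (u \in E).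
  by rewrite (bigD1_seq u) //= eqxx big1 ?addr0 // => v /negPf->.
rewrite big_seq big1 => [|v vE].
  by apply/eqP; apply: contraNT uE' => /hP/PE.
by case: eqVneq => // vu; rewrite -vu vE in uE'.
Qed.

Theorem theorem3 (R : realType) (n : nat) (K : idomainType) (m : idealr K)
    (L : closedFieldType) (iota : {rmorphism {ideal_quot m} -> L})
    (Gamma : set 'rV[R]_n) (f : 'I_n.+1 -> laurent K n) (g : laurent K n) :
  is_field K \/ is_dvr K ->
  maximal_ideal m ->
  algebraic_closure iota ->
  polytope Gamma ->
  (forall v, vertex Gamma v -> exists u : 'rV[int]_n, v = real_point R u) ->
  affine_dim Gamma = n ->
  (forall i, support_in (f i) Gamma) ->
  support_in g (dilate n.+1 Gamma) ->
  (forall gamma : set 'rV[R]_n, face Gamma gamma ->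
     ~ exists z : 'rV[L]_n,
         (forall j, z 0 j != 0) /\
         forall i,
           laurent_eval iota z
             (laurent_restrict gamma (laurent_map (residue m) (f i))) = 0) ->
  exists h : 'I_n.+1 -> laurent K n,
    (forall i, support_in (h i) (dilate n Gamma)) /\
    g = \sum_(i < n.+1) h i * f i.
Proof.
move=> localK mmax _ polyG vertG _ fG gG no_zero.
have [r [W [Wvert GW]]] := polytope_vertices polyG.
have /choice[V VE] : forall i, exists u : 'rV[int]_n, W i = real_point R u.
  by move=> i; exact: vertG.
have {VE}WE : W = (fun i => real_point R (V i)) by apply/funext.
subst W.
have slice_dilate d u : lattice_slice R V d u -> dilate d Gamma (real_point R u).
  case: d => [|d] uS.
    (* For [d = 0] one cannot divide by [d]; any point of [Gamma] is a preimage of 0. *)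
    exists (real_point R (V ord0)); first by apply/GW; exact: in_slice_pt.
    have [c [c0 c1 ->]] := uS; rewrite scale0r big1 // => i _.
    have : \sum_i c i == 0 by rewrite c1.
    by rewrite psumr_eq0 // => /allP/(_ i); rewrite mem_index_enum => /(_ isT)/eqP->;
      rewrite scale0r.
  exists (d.+1%:R^-1 *: real_point R u).
    have d0 : 0 <= (d.+1%:R)^-1 :> R by rewrite invr_ge0 ler0n.
    have := in_sliceZ d0 uS; rewrite mulVf ?pnatr_eq0 // => /GW; exact.
  by rewrite scalerA mulfV ?pnatr_eq0 // scale1r.
have dilate_slice d u : dilate d Gamma (real_point R u) -> lattice_slice R V d u.
  case=> x /GW xS E; rewrite /lattice_slice -E -[X in in_slice _ X _]mulr1.
  exact: (in_sliceZ (ler0n _ _) xS).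
pose psi : {rmorphism K -> L} := iota \o \pi_({ideal_quot m})%qT.
have psiE x : psi x = iota (residue m x) by [].
have psi_unit x : psi x != 0 -> x \is a GRing.unit.
  move=> px; apply: (local_unit localK mmax); apply: contraNN px => xm.
  have -> : psi x = psi 0; last by rewrite rmorph0.
  congr (iota _); apply/eqP; rewrite -Quotient.idealrBE subr0.
  exact: xm.
have fS i : supported (f i) (lattice_slice R V 1).
  move=> u /fG uG; rewrite /lattice_slice mulr1n; exact/GW.
pose F i := laurent_map psi (f i).
have coefF i u : laurent_coef (F i) u = psi (laurent_coef (f i) u).
  by apply: laurent_coef_map; exact: rmorph0.
have FS i : supported (F i) (lattice_slice R V 1).
  move=> u; rewrite coefF => fu; apply: (fS i); apply: contraNneq fu => ->.
  by rewrite rmorph0.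
have no_zeroF (l : 'cV[R]_n) b : (forall i, b <= dot (real_point R (V i)) l) ->
    (exists i, dot (real_point R (V i)) l = b) ->
    ~ exists z : 'rV[L]_n, (forall j, z 0 j != 0) /\
      forall i, laurent_eval idfun z (laurent_restrict [set x | dot x l = b] (F i)) = 0.
  move=> bV [i0 bi0] [z [z0 zF]].
  have dotN y : (y *m - l) 0 0 = - dot y l by rewrite mulmxN mxE.
  apply: (no_zero (Gamma `&` [set x | (x *m - l) 0 0 = - b])).
    split.
      exists (real_point R (V i0)); split; last by rewrite /= dotN bi0.
      by apply/GW; exact: (in_slice_pt (fun i => real_point R (V i))).
    exists (- l), (- b); split=> // x /GW xS.
    by rewrite dotN lerN2 -[b]mul1r; exact: in_slice_dual xS bV.
  exists z; split; first exact: z0.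
  move=> i; rewrite -(zF i).
  have res0 : residue m 0 = 0.
    exact: (rmorph0 (\pi_({ideal_quot m})%qT : {rmorphism K -> {ideal_quot m}})).
  (* Reduction and restriction shrink supports, so both evaluations are expanded over the support of
     [f i]. *)
  rewrite (@laurent_evalE _ _ _ _ _ _ (msupp (f i))) ?rmorph0 //; last first.
    move=> u; rewrite laurent_coef_restrict; case: ifP => _; last by rewrite eqxx.
    rewrite laurent_coef_map // mem_laurent_supp; apply: contra_neq => ->.
    exact: res0.
  rewrite (@laurent_evalE _ _ _ _ _ _ (msupp (f i))) //; last first.
    move=> u; rewrite laurent_coef_restrict; case: ifP => _; last by rewrite eqxx.
    by rewrite coefF mem_laurent_supp; apply: contra_neq => ->; rewrite rmorph0.
  rewrite big_seq [RHS]big_seq; apply: eq_bigr => u; rewrite mem_laurent_supp => /fG uG.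
  congr (_ * _); rewrite !laurent_coef_restrict coefF laurent_coef_map //=.
  have -> : `[< (Gamma `&` [set x | (x *m - l) 0 0 = - b]) (real_point R u) >] =
      `[< [set x | dot x l = b] (real_point R u) >].
    apply: asbool_equiv_eq; split=> [[_]|ub] /=; first by rewrite dotN => /oppr_inj.
    by split=> //=; rewrite dotN ub.
  by case: ifP => _; rewrite ?rmorph0.
have [E0 uE0 E0P] := finite_lattice_slice R V n.
have [E1 uE1 E1P] := finite_lattice_slice R V n.+1.
(* The unknowns are the coefficients of all [h i] at exponents in n Gamma, with one equation for
   each exponent in (n + 1) Gamma. *)
pose A := ('I_n.+1 * 'I_(size E0))%type.
pose M (a : A) (c : 'I_(size E1)) :=
  laurent_coef (f a.1) (E1`_c - E0`_a.2).
have [c|x xE] := @lift_surjectivity K L psi A 'I_(size E1) M psi_unit _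
    (fun c => laurent_coef g E1`_c).
  have cS : lattice_slice R V n.+1 E1`_c by apply/E1P; exact: mem_nth.
  have r_gt0 : (0 < #|'I_r.+1|)%N by rewrite card_ord.
  have [H [HS HE]] := monomial_in_ideal r_gt0 FS no_zeroF cS.
  exists (fun a : A => laurent_coef (H a.1) E0`_a.2) => c'.
  have HSE i : H i = \sum_(k < size E0) laurent_monom (laurent_coef (H i) E0`_k) E0`_k.
    exact: laurent_sum_nth uE0 (fun u => proj2 (E0P u)) (HS i).
  have -> : (c == c')%:R = laurent_coef (laurent_monom 1 E1`_c : laurent L n) E1`_c'.
    by rewrite laurent_coef_monom nth_uniq.
  rewrite HE laurent_coef_sum.
  transitivity (\sum_(i < n.+1) \sum_(k < size E0)
      laurent_coef (H i) E0`_k * psi (M (i, k) c')).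
    by rewrite pair_bigA; apply: eq_bigr => -[].
  apply: eq_bigr => i _; rewrite [in RHS]HSE mulr_suml laurent_coef_sum.
  apply: eq_bigr => k _; rewrite laurent_coef_monomM coefF.
  exact: erefl.
exists (fun i => \sum_(k < size E0) laurent_monom (x (i, k)) E0`_k).
have hS i : supported (\sum_(k < size E0) laurent_monom (x (i, k)) E0`_k) (lattice_slice R V n).
  apply: supported_sum => k; apply: supported_monom => _.
  by apply/E0P; exact: mem_nth.
split=> [i u /hS|]; first exact: slice_dilate.
apply: laurent_ext => u.
have [/(nthP 0)[c cE <-]|uE] := boolP (u \in E1).
  rewrite -(xE (Ordinal cE)) laurent_coef_sum.
  transitivity (\sum_(i < n.+1) \sum_(k < size E0) x (i, k) * M (i, k) (Ordinal cE)).
    by rewrite pair_bigA; apply: eq_bigr => -[].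
  apply: eq_bigr => i _; rewrite mulr_suml laurent_coef_sum.
  by apply: eq_bigr => k _; rewrite laurent_coef_monomM.
have outside h : supported h (lattice_slice R V n.+1) -> laurent_coef h u = 0.
  by move=> hP; apply/eqP; apply: contraNT uE => /hP uS; apply/E1P.
rewrite !outside //; last by move=> v /gG; exact: dilate_slice.
apply: supported_sum => i; apply: supportedM (hS i) (fS i) _ => v w vS wS.
by rewrite -[X in lattice_slice _ _ X _]addn1; exact: lattice_sliceD.
Qed.
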